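(* Let $p\ge 2$ and $q$ be coprime integers, $I_1,I_3>0$, $\eta=I_1/I_3-1$, and consider $L(p;q)$ with the Berger metric and base point $o=\Pi(\mathrm{id})$. For $h\in C$ let $t_{\mathrm{cut}}(h)$ be the cut time of the unit-speed geodesic $\Pi\circ\gamma_h$ (the supremum of $t>0$ such that $\Pi\circ\gamma_h|_{[0,t]}$ is length-minimizing in $L(p;q)$). Then: if $\eta\ge-\frac{p-1}{p}$, then $t_{\mathrm{cut}}(h)=\dfrac{2I_1\tau_\ell(\bar h_3)}{|h|}=2\sqrt{I_1}\sqrt{1+\eta\bar h_3^2}\,\tau_\ell(\bar h_3)$ for all $h\in C$; if $-1<\eta<-\frac{p-1}{p}$, then $$t_{\mathrm{cut}}(h)=\begin{cases}\dfrac{2I_1\pi}{|h|}, & |\bar h_3|\ge\frac{p-1}{p|\eta|},\\[2mm] \dfrac{2I_1\tau_\ell(\bar h_3)}{|h|}, & |\bar h_3|<\frac{p-1}{p|\eta|}.\end{cases}$$ In all cases the cut time equals the first Maxwell time $t_{\max}(h)=2I_1\min(\pi,\tau_\ell(\bar h_3))/|h|$.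
   Context: Identify $S^3=\{(z,w)\in\mathbb{C}^2:|z|^2+|w|^2=1\}$ with $\mathrm{SU}_2$ via $(z,w)\mapsto\begin{pmatrix} z& w\\ -\bar w&\bar z\end{pmatrix}$, write $z=q_0+iq_3$, $w=q_1+iq_2$. The basis of $\mathfrak{su}_2$ is $e_1=\frac12\begin{pmatrix}0&1\\-1&0\end{pmatrix}$, $e_2=\frac12\begin{pmatrix}0&i\\ i&0\end{pmatrix}$, $e_3=\frac12\begin{pmatrix}i&0\\0&-i\end{pmatrix}$. The metric $g$ is the left-invariant metric on $\mathrm{SU}_2$ equal to $I_1u_1^2+I_1u_2^2+I_3u_3^2$ at the identity on $u_1e_1+u_2e_2+u_3e_3$; it is invariant under the $\mathbb{Z}_p$-action $[k]\cdot(z,w)=(e^{2\pi ik/p}z,e^{2\pi ikq/p}w)$, so it descends to the lens space $L(p;q)=S^3/\mathbb{Z}_p$ (projection $\Pi$); this is the Berger metric on $L(p;q)$. Let $C=\{h=(h_1,h_2,h_3)\in\mathfrak{su}_2^*: \frac{h_1^2+h_2^2}{I_1}+\frac{h_3^2}{I_3}=1\}$ (coordinates in the dual basis); each $h\in C$ determines the arclength-parametrized geodesic $\gamma_h$ of $(\mathrm{SU}_2,g)$ from the identity (projection of the Hamiltonian flow of $H=\frac12(\frac{h_1^2+h_2^2}{I_1}+\frac{h_3^2}{I_3})$ starting at $h$); every unit-speed geodesic of $L(p;q)$ from $o$ is $\Pi\circ\gamma_h$ for some $h\in C$. Put $|h|=\sqrt{h_1^2+h_2^2+h_3^2}$, $\bar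 h_i=h_i/|h|$, $\tau=2I_1t/|h|$. Along $\gamma_h$: $q_0=\cos\tau\cos(\tau\eta\bar h_3)-\bar h_3\sin\tau\sin(\tau\eta\bar h_3)$, $q_3=\cos\tau\sin(\tau\eta\bar h_3)+\bar h_3\sin\tau\cos(\tau\eta\bar h_3)$. Define $\ell_\mp(\tau,s)=\cos\tau\sin(\tau\eta s\mp\frac{\pi}{p})+s\sin\tau\cos(\tau\eta s\mp\frac{\pi}{p})$, let $\tau_\ell^\mp(s)$ be the smallest positive root in $\tau$ of $\ell_\mp(\tau,s)=0$ and $\tau_\ell(s)=\min(\tau_\ell^-(s),\tau_\ell^+(s))$. *)

(* Defs.v *)
From Stdlib Require Import Reals ZArith.
From Coquelicot Require Import Coquelicot.
Open Scope R_scope.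

(* A point (z,w) of C^2 with z = q0 + i q3, w = q1 + i q2; identified with the
   matrix [[z, w], [-conj w, conj z]] (an element of SU_2 when on S^3). *)
Record quat := mkQ { q0 : R; q1 : R; q2 : R; q3 : R }.

(* Matrix product (z,w)(z',w') = (z z' - w conj w', z w' + w conj z'),
   written out in real coordinates. *)
Definition qmul (x y : quat) : quat :=
  mkQ (q0 x * q0 y - q3 x * q3 y - q1 x * q1 y - q2 x * q2 y)
      (q0 x * q1 y + q1 x * q0 y - q3 x * q2 y + q2 x * q3 y)
      (q0 x * q2 y + q2 x * q0 y + q3 x * q1 y - q1 x * q3 y)
      (q0 x * q3 y + q3 x * q0 y + q1 x * q2 y - q2 x * q1 y).

(* inverse of an element of SU_2: (conj z, -w) *)
Definition qinv (x : quat) : quat := mkQ (q0 x) (- q1 x) (- q2 x) (- q3 x).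

Definition qid : quat := mkQ 1 0 0 0.

Definition on_S3 (x : quat) : Prop :=
  q0 x ^ 2 + q1 x ^ 2 + q2 x ^ 2 + q3 x ^ 2 = 1.

(* u1 e1 + u2 e2 + u3 e3 in su_2, with
   e1 = 1/2 [[0,1],[-1,0]], e2 = 1/2 [[0,i],[i,0]], e3 = 1/2 [[i,0],[0,-i]] *)
Definition alg (u1 u2 u3 : R) : quat := mkQ 0 (u1 / 2) (u2 / 2) (u3 / 2).

Definition au1 (X : quat) : R := 2 * q1 X.
Definition au2 (X : quat) : R := 2 * q2 X.
Definition au3 (X : quat) : R := 2 * q3 X.

Definition berger_norm (I1 I3 : R) (x v : quat) : R :=
  let X := qmul (qinv x) v in
  sqrt (I1 * au1 X ^ 2 + I1 * au2 X ^ 2 + I3 * au3 X ^ 2).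

Definition C1_curve (c dc : R -> quat) : Prop :=
  forall t,
    is_derive (fun s => q0 (c s)) t (q0 (dc t)) /\
    is_derive (fun s => q1 (c s)) t (q1 (dc t)) /\
    is_derive (fun s => q2 (c s)) t (q2 (dc t)) /\
    is_derive (fun s => q3 (c s)) t (q3 (dc t)) /\
    continuous (fun s => q0 (dc s)) t /\ continuous (fun s => q1 (dc s)) t /\
    continuous (fun s => q2 (dc s)) t /\ continuous (fun s => q3 (dc s)) t.

Definition admissible_curve (c dc : R -> quat) (a b : R) : Prop :=
  a <= b /\ C1_curve c dc /\ (forall t, a <= t <= b -> on_S3 (c t)).

Definition curve_length (I1 I3 : R) (c dc : R -> quat) (a b : R) : R :=
  RInt (fun t => berger_norm I1 I3 (c t) (dc t)) a b.

(* Z_p action [k].(z,w) = (e^{2 pi i k/p} z, e^{2 pi i k q/p} w) *)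
Definition lens_act (p q k : Z) (x : quat) : quat :=
  let a := 2 * PI * IZR k / IZR p in
  let b := 2 * PI * IZR k * IZR q / IZR p in
  mkQ (cos a * q0 x - sin a * q3 x)
      (cos b * q1 x - sin b * q2 x)
      (sin b * q1 x + cos b * q2 x)
      (sin a * q0 x + cos a * q3 x).

(* Pi x = Pi y in L(p;q) *)
Definition lens_equiv (p q : Z) (x y : quat) : Prop :=
  exists k : Z, y = lens_act p q k x.

(* (gam, M) is the trajectory of the Hamiltonian flow of
   H = 1/2 ((h1^2+h2^2)/I1 + h3^2/I3) (left trivialization T*SU_2 = SU_2 x dual of su_2)
   starting at (id, h):  gam' = gam . dH(M),  M' = ad*_{dH(M)} M = M x omega,
   where omega = dH(M) = (M1/I1, M2/I1, M3/I3) and [e1,e2]=e3 (cyclically). *)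
Definition hamiltonian_traj (I1 I3 h1 h2 h3 : R) (gam : R -> quat)
    (M1 M2 M3 : R -> R) : Prop :=
  gam 0 = qid /\ M1 0 = h1 /\ M2 0 = h2 /\ M3 0 = h3 /\
  forall t,
    let w1 := M1 t / I1 in let w2 := M2 t / I1 in let w3 := M3 t / I3 in
    is_derive M1 t (M2 t * w3 - M3 t * w2) /\
    is_derive M2 t (M3 t * w1 - M1 t * w3) /\
    is_derive M3 t (M1 t * w2 - M2 t * w1) /\
    let v := qmul (gam t) (alg w1 w2 w3) in
    is_derive (fun s => q0 (gam s)) t (q0 v) /\
    is_derive (fun s => q1 (gam s)) t (q1 v) /\
    is_derive (fun s => q2 (gam s)) t (q2 v) /\
    is_derive (fun s => q3 (gam s)) t (q3 v).

Definition traj_velocity (I1 I3 : R) (gam : R -> quat) (M1 M2 M3 : R -> R)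
    (t : R) : quat :=
  qmul (gam t) (alg (M1 t / I1) (M2 t / I1) (M3 t / I3)).

(* Pi o gam restricted to [0,t] is length-minimizing in L(p;q): every curve in
   L(p;q) between its endpoints (i.e. every curve in S^3 from a point of the
   fibre of o to a point of the fibre of Pi(gam t)) is at least as long. *)
Definition minimizing_upto (p q : Z) (I1 I3 : R) (gam : R -> quat)
    (M1 M2 M3 : R -> R) (t : R) : Prop :=
  forall (c dc : R -> quat) (a b : R),
    admissible_curve c dc a b ->
    lens_equiv p q qid (c a) -> lens_equiv p q (gam t) (c b) ->
    curve_length I1 I3 gam (traj_velocity I1 I3 gam M1 M2 M3) 0 t
      <= curve_length I1 I3 c dc a b.

Definition is_cut_time (p q : Z) (I1 I3 : R) (gam : R -> quat)
    (M1 M2 M3 : R -> R) (T : R) : Prop :=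
  is_lub (fun t => 0 < t /\ minimizing_upto p q I1 I3 gam M1 M2 M3 t) T.

(* l_-(tau,s) (sg = -1) and l_+(tau,s) (sg = 1) *)
Definition ell (eta : R) (p : Z) (sg : R) (tau s : R) : R :=
  cos tau * sin (tau * eta * s + sg * PI / IZR p)
  + s * sin tau * cos (tau * eta * s + sg * PI / IZR p).

Definition first_pos_root (f : R -> R) (tau : R) : Prop :=
  0 < tau /\ f tau = 0 /\ forall t, 0 < t < tau -> f t <> 0.

(* Main.v *)
Require Import Defs.
From Stdlib Require Import Reals ZArith Lra Lia.
From Coquelicot Require Import Coquelicot.
Open Scope R_scope.

(** A curve of [S^3] enters only through [a], half the length of its projection to the base
    of the Hopf fibration, and [b], half its total displacement along the fibres. Its Berger
    length is at least [2 sqrt (I1 a^2 + I3 b^2)], with equality once the displacement is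
    spread proportionally to the horizontal speed. Spreading instead a displacement [psi]
    and measuring with the round metric gives, for every [psi],
    [acos (Re (z exp (i (psi - b)))) ^ 2 <= a^2 + psi^2] where [z] is the first coordinate
    of the endpoint. Since the translates of the base point differ by phases of [z], the
    minimality of a geodesic before the parameter [min (PI, tau_l)] becomes a two-variable
    inequality, solved by choosing [psi]. Past that parameter an explicit cheaper curve is
    a round geodesic followed by a uniform twist along the fibre, reaching the same fibre
    of the covering: either the mirror image of the given geodesic, or one over a shorter
    circle of the base with suitable holonomy. The comparison of circles rests on the
    exponential map of the round sphere being a contraction. *)

(** * Cosine inequalities *)

(** For [0 <= s] the phase of the first coordinate is [be + eta * tau * s], where [be] is the
    argument of [cos tau + i s sin tau]. The functions [ell] vanish when this phase meets [PI / p]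
    or [- PI / p] modulo [PI]; until then no translate has a phase closer to [0], and afterwards the
    translate [j = -1] offers something cheaper. At [tau = PI] the phase is [PI (1 + eta s)], and
    comparing it with [PI / p] gives the threshold [(p - 1) / (p |eta|)]. The sign of [eta] decides
    how the lower bound is closed. Once [psi] is chosen as [b] plus a constant, a quadratic
    polynomial in [b] remains, with leading coefficient [- eta / (1 + eta)]. For [eta < 0] it is
    bounded below by completing a square. For [eta >= 0] this fails, and convexity of the squared
    round distance as a function of the phase takes over; it is used for phases up to [PI / 2] only,
    which suffices because then [tau_l <= PI / 2]. *)

Lemma nondecreasing_of_derive (f df : R -> R) (a b : R) :
  a <= b -> (forall t, a <= t <= b -> is_derive f t (df t)) ->
  (forall t, a < t < b -> 0 <= df t) -> f a <= f b.
Proof.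
intros Hab Hd Hp.
destruct (Req_dec a b) as [->|Hne]; [lra|].
assert (Hlt : a < b) by lra.
destruct (MVT_cor2 f df a b Hlt) as [c [Hc Hc']].
{ intros c Hc; apply is_derive_Reals; auto. }
specialize (Hp c Hc'); nra.
Qed.

Lemma increasing_of_derive (f df : R -> R) (a b : R) :
  a < b -> (forall t, a <= t <= b -> is_derive f t (df t)) ->
  (forall t, a < t < b -> 0 < df t) -> f a < f b.
Proof.
intros Hab Hd Hp.
destruct (MVT_cor2 f df a b Hab) as [c [Hc Hc']].
{ intros c Hc; apply is_derive_Reals; auto. }
specialize (Hp c Hc'); nra.
Qed.

Lemma mul_cos_lt_sin (x : R) : 0 < x < PI -> x * cos x < sin x.
Proof.
intros Hx.
pose proof (increasing_of_derive (fun t => sin t - t * cos t) (fun t => t * sin t) 0 x) as H.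
cbv beta in H; rewrite sin_0 in H.
enough (0 - 0 * cos 0 < sin x - x * cos x) by lra.
apply H; [lra| |].
- intros t _; auto_derive; [trivial|ring].
- intros t Ht; apply Rmult_lt_0_compat; [lra|apply sin_gt_0; lra].
Qed.

Lemma sin_div_decreasing (x y : R) : 0 < x -> x < y -> y <= PI -> sin y / y < sin x / x.
Proof.
intros Hx Hxy Hy.
enough (- (sin x / x) < - (sin y / y)) by lra.
apply (increasing_of_derive (fun t => - (sin t / t)) (fun t => (sin t - t * cos t) / t ^ 2) x y); [lra| |].
- intros t Ht; auto_derive; [lra|field; lra].
- intros t Ht; apply Rdiv_lt_0_compat; [|nra].
  pose proof (mul_cos_lt_sin t); lra.
Qed.

(* [cos (sqrt x)] is convex on [0, PI^2]; beyond, its tangents stay below [-1]. *)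
Lemma cos_tangent_sq_lt (L y : R) :
  0 < L <= PI -> 0 <= y < L -> cos L - sin L / (2 * L) * (y ^ 2 - L ^ 2) < cos y.
Proof.
intros HL Hy.
pose proof (increasing_of_derive
  (fun t => - cos t - sin L / (2 * L) * t ^ 2)
  (fun t => sin t - sin L / L * t) y L) as H; cbv beta in H.
enough (- cos y - sin L / (2 * L) * y ^ 2 < - cos L - sin L / (2 * L) * L ^ 2) by lra.
apply H; [lra| |].
- intros t Ht; auto_derive; [trivial|field; lra].
- intros t Ht.
  pose proof (sin_div_decreasing t L ltac:(lra) ltac:(lra) ltac:(lra)) as Hs.
  replace (sin t) with (sin t / t * t) by (field; lra).
  nra.
Qed.

Lemma cos_tangent_sq (L y : R) :
  0 < L <= PI -> cos L - sin L / (2 * L) * (y ^ 2 - L ^ 2) <= cos y.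
Proof.
intros HL.
assert (Hpos : 0 <= sin L / (2 * L)).
{ apply Rmult_le_pos; [apply sin_ge_0; lra|]. apply Rlt_le, Rinv_0_lt_compat; lra. }
assert (Hin : forall y, L <= y <= PI -> cos L - sin L / (2 * L) * (y ^ 2 - L ^ 2) <= cos y).
{ intros z Hz.
  pose proof (nondecreasing_of_derive
    (fun t => cos t + sin L / (2 * L) * t ^ 2)
    (fun t => sin L / L * t - sin t) L z) as H; cbv beta in H.
  enough (cos L + sin L / (2 * L) * L ^ 2 <= cos z + sin L / (2 * L) * z ^ 2) by lra.
  apply H; [lra| |].
  - intros t Ht; auto_derive; [trivial|field; lra].
  - intros t Ht.
    pose proof (sin_div_decreasing L t ltac:(lra) ltac:(lra) ltac:(lra)) as Hs.
    replace (sin t) with (sin t / t * t) by (field; lra).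
    nra. }
assert (H0 : forall y, 0 <= y -> cos L - sin L / (2 * L) * (y ^ 2 - L ^ 2) <= cos y).
{ intros z Hz.
  destruct (Rlt_le_dec z L) as [H1|H1]; [apply Rlt_le, cos_tangent_sq_lt; lra|].
  destruct (Rle_lt_dec z PI) as [H2|H2]; [apply Hin; lra|].
  pose proof (Hin PI ltac:(lra)) as H3; rewrite cos_PI in H3.
  pose proof (COS_bound z).
  assert (sin L / (2 * L) * PI ^ 2 <= sin L / (2 * L) * z ^ 2) by (apply Rmult_le_compat_l; nra).
  lra. }
destruct (Rle_lt_dec 0 y) as [Hy|Hy]; [now apply H0|].
rewrite <- (cos_neg y); replace (y ^ 2) with ((- y) ^ 2) by ring.
apply H0; lra.
Qed.

Lemma sq_lt (x y : R) : 0 <= x < y -> x ^ 2 < y ^ 2.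
Proof. intros H; nra. Qed.

Lemma sq_le (x y : R) : 0 <= x <= y -> x ^ 2 <= y ^ 2.
Proof. intros H; nra. Qed.

Lemma le_of_cos_le (x y : R) : 0 <= x <= PI -> 0 <= y <= PI -> cos y <= cos x -> x <= y.
Proof.
intros Hx Hy H; destruct (Rle_lt_dec x y) as [|Hlt]; [assumption|].
pose proof (cos_decreasing_1 y x); lra.
Qed.

Lemma lt_of_cos_lt (x y : R) : 0 <= x <= PI -> 0 <= y <= PI -> cos y < cos x -> x < y.
Proof.
intros Hx Hy H; destruct (Rlt_le_dec x y) as [|Hlt]; [assumption|].
pose proof (cos_decr_1 y x); lra.
Qed.

(* The exponential map of the round sphere does not increase distances: the spherical
   third side of a triangle is at most the Euclidean one. *)
Lemma spherical_side_le (s tau del sig : R) :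
  -1 <= s <= 1 -> 0 <= sig <= PI ->
  cos sig = cos tau * cos del + s * sin tau * sin del ->
  sig ^ 2 <= tau ^ 2 - 2 * tau * s * del + del ^ 2.
Proof.
intros Hs Hsig Hc.
set (X := tau ^ 2 - 2 * tau * s * del + del ^ 2).
(* [X] averages the squares of [tau - del] and [tau + del] with the weights by which [cos sig]
   averages their cosines. Jensen's inequality for the convex function [cos (sqrt x)], taken through
   its tangent at [X], gives [cos L <= cos sig]. *)
assert (HX : X = (1 + s) / 2 * (tau - del) ^ 2 + (1 - s) / 2 * (tau + del) ^ 2) by (unfold X; field).
assert (HX0 : 0 <= X).
{ rewrite HX; pose proof (pow2_ge_0 (tau - del)); pose proof (pow2_ge_0 (tau + del)); nra. }
set (L := sqrt X).
assert (HL : L ^ 2 = X) by (unfold L; rewrite <- Rsqr_pow2; now apply Rsqr_sqrt).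
assert (HLp : 0 <= L) by apply sqrt_pos.
destruct (Rlt_le_dec PI L) as [H|H]; [rewrite <- HL; first [apply sq_lt|apply sq_le]; lra|].
assert (Hle : cos L <= cos sig).
(* The slope [- sin L / (2 * L)] of the tangent makes no sense at [L = 0], so the degenerate
   triangle is computed by hand. *)
{ destruct (Req_dec L 0) as [H0|H0].
  - assert (X = 0) by (rewrite <- HL, H0; ring).
    assert (tau ^ 2 * (1 - s ^ 2) + (del - s * tau) ^ 2 = 0) by (rewrite <- H1; unfold X; ring).
    pose proof (pow2_ge_0 (del - s * tau)); pose proof (pow2_ge_0 tau).
    assert (0 <= tau ^ 2 * (1 - s ^ 2)) by (apply Rmult_le_pos; nra).
    assert (tau ^ 2 * (1 - s ^ 2) = 0) by lra.
    assert (Hd : del = s * tau) by (apply Rminus_diag_uniq, Rsqr_0_uniq; rewrite Rsqr_pow2; lra).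
    rewrite Hc, H0, cos_0.
    destruct (Req_dec tau 0) as [Ht|Ht].
    + rewrite Hd, Ht, Rmult_0_r, cos_0, sin_0; lra.
    + assert (Hs2 : (1 - s) * (1 + s) = 0) by (assert (0 < tau ^ 2) by nra; nra).
      destruct (Rmult_integral _ _ Hs2).
      * assert (Es : s = 1) by lra; rewrite Hd, Es, Rmult_1_l.
        pose proof (sin2_cos2 tau) as E; unfold Rsqr in E; lra.
      * assert (Es : s = -1) by lra; rewrite Hd, Es.
        replace (-1 * tau) with (- tau) by ring; rewrite cos_neg, sin_neg.
        pose proof (sin2_cos2 tau) as E; unfold Rsqr in E; lra.
  - pose proof (cos_tangent_sq L (tau - del) ltac:(lra)) as H1.
    pose proof (cos_tangent_sq L (tau + del) ltac:(lra)) as H2.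
    rewrite HL in H1, H2.
    set (k := sin L / (2 * L)) in *.
    assert (E : cos sig = (1 + s) / 2 * cos (tau - del) + (1 - s) / 2 * cos (tau + del)).
    { rewrite cos_minus, cos_plus, Hc; field. }
    assert (E2 : (1 + s) / 2 * (cos L - k * ((tau - del) ^ 2 - X)) +
       (1 - s) / 2 * (cos L - k * ((tau + del) ^ 2 - X)) = cos L) by (rewrite HX; field).
    rewrite E, <- E2.
    apply Rplus_le_compat; apply Rmult_le_compat_l; lra. }
pose proof (le_of_cos_le sig L Hsig ltac:(lra) Hle). rewrite <- HL; apply sq_le; lra.
Qed.

(** The side [tau > PI] excludes equality. If [del = 0], then [sig <= PI < tau]. Otherwise the
    squares of [tau - del] and [tau + del] differ, so one of them lies below their average [X], and
    there the tangent inequality is strict. *)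
Lemma spherical_side_lt (s tau del sig : R) :
  -1 < s < 1 -> PI < tau -> 0 <= sig <= PI ->
  cos sig = cos tau * cos del + s * sin tau * sin del ->
  sig ^ 2 < tau ^ 2 - 2 * tau * s * del + del ^ 2.
Proof.
intros Hs Ht Hsig Hc.
pose proof PI_RGT_0 as Hpi.
destruct (Req_dec del 0) as [->|Hd].
{ replace (tau ^ 2 - 2 * tau * s * 0 + 0 ^ 2) with (tau ^ 2) by ring; apply sq_lt; lra. }
set (X := tau ^ 2 - 2 * tau * s * del + del ^ 2).
assert (HX : X = (1 + s) / 2 * (tau - del) ^ 2 + (1 - s) / 2 * (tau + del) ^ 2) by (unfold X; field).
assert (HX0 : 0 < X).
{ replace X with ((1 - s ^ 2) * tau ^ 2 + (del - s * tau) ^ 2) by (unfold X; ring).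
  assert (0 < (1 - s ^ 2) * tau ^ 2) by (apply Rmult_lt_0_compat; nra).
  pose proof (pow2_ge_0 (del - s * tau)); lra. }
set (L := sqrt X).
assert (HL : L ^ 2 = X) by (unfold L; rewrite <- Rsqr_pow2; apply Rsqr_sqrt; lra).
assert (HLp : 0 < L) by (now apply sqrt_lt_R0).
destruct (Rlt_le_dec PI L) as [H|H]; [rewrite <- HL; first [apply sq_lt|apply sq_le]; lra|].
assert (Hlt : cos L < cos sig).
{ pose proof (cos_tangent_sq L (tau - del) ltac:(lra)) as H1.
  pose proof (cos_tangent_sq L (tau + del) ltac:(lra)) as H2.
  assert (H3 : forall y, y ^ 2 < X -> cos L - sin L / (2 * L) * (y ^ 2 - L ^ 2) < cos y).
  { intros y Hy. rewrite <- (Rabs_right (y ^ 2)) by (apply Rle_ge, pow2_ge_0).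
    rewrite <- RPow_abs.
    assert (Ey : cos (Rabs y) = cos y).
    { unfold Rabs; destruct (Rcase_abs y); [apply cos_neg|trivial]. }
    rewrite <- Ey; apply cos_tangent_sq_lt; [lra|].
    split; [apply Rabs_pos|]. pose proof (Rabs_pos y).
    assert (Rabs y ^ 2 = y ^ 2) by (rewrite <- !Rsqr_pow2; symmetry; apply Rsqr_abs). nra. }
  assert (E : cos sig = (1 + s) / 2 * cos (tau - del) + (1 - s) / 2 * cos (tau + del)).
  { rewrite cos_minus, cos_plus, Hc; field. }
  assert (E2 : (1 + s) / 2 * (cos L - sin L / (2 * L) * ((tau - del) ^ 2 - L ^ 2)) +
     (1 - s) / 2 * (cos L - sin L / (2 * L) * ((tau + del) ^ 2 - L ^ 2)) = cos L)
    by (rewrite HL, HX; field; lra).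
  destruct (Rlt_le_dec ((tau - del) ^ 2) X) as [H4|H4].
  - specialize (H3 _ H4). rewrite E, <- E2.
    apply Rplus_lt_le_compat; [apply Rmult_lt_compat_l|apply Rmult_le_compat_l]; lra.
  - assert (H5 : (tau + del) ^ 2 < X).
    { assert ((tau + del) ^ 2 <> (tau - del) ^ 2).
      { intro E'. assert (4 * (tau * del) = 0) by lra.
        assert (tau * del <> 0) by (apply Rmult_integral_contrapositive; split; lra). lra. }
      assert ((1 - s) / 2 * (tau + del) ^ 2 = X - (1 + s) / 2 * (tau - del) ^ 2) by lra.
      destruct (Rlt_le_dec ((tau + del) ^ 2) X) as [|H6]; [assumption|exfalso].
      assert (X = (1 + s) / 2 * X + (1 - s) / 2 * X) by field.
      assert ((1 + s) / 2 * X <= (1 + s) / 2 * (tau - del) ^ 2) by (apply Rmult_le_compat_l; lra).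
      assert ((1 - s) / 2 * X <= (1 - s) / 2 * (tau + del) ^ 2) by (apply Rmult_le_compat_l; lra).
      assert ((1 + s) / 2 * ((tau - del) ^ 2 - X) = 0) by lra.
      assert ((1 - s) / 2 * ((tau + del) ^ 2 - X) = 0) by lra.
      assert ((tau - del) ^ 2 - X = 0) by (apply (Rmult_eq_reg_l ((1 + s) / 2)); lra).
      assert ((tau + del) ^ 2 - X = 0) by (apply (Rmult_eq_reg_l ((1 - s) / 2)); lra).
      lra. }
    specialize (H3 _ H5). rewrite E, <- E2.
    apply Rplus_le_lt_compat; [apply Rmult_le_compat_l|apply Rmult_lt_compat_l]; lra. }
pose proof (lt_of_cos_lt sig L Hsig ltac:(lra) Hlt). rewrite <- HL; apply sq_lt; lra.
Qed.

(** * Polar form of the endpoint of a geodesic *)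

Lemma cos_2PI_IZR (x : R) (n : Z) : cos (x + 2 * PI * IZR n) = cos x.
Proof.
destruct (Z_le_dec 0 n) as [H|H].
- rewrite <- (Z2Nat.id n H), <- INR_IZR_INZ.
  replace (2 * PI * INR (Z.to_nat n)) with (2 * INR (Z.to_nat n) * PI) by ring.
  apply cos_period.
- rewrite <- (cos_period _ (Z.to_nat (- n))), INR_IZR_INZ, Z2Nat.id by lia.
  rewrite opp_IZR; f_equal; ring.
Qed.

Lemma sin_2PI_IZR (x : R) (n : Z) : sin (x + 2 * PI * IZR n) = sin x.
Proof.
rewrite <- !cos_shift.
replace (PI / 2 - (x + 2 * PI * IZR n)) with (PI / 2 - x + 2 * PI * IZR (- n))
  by (rewrite opp_IZR; ring).
apply cos_2PI_IZR.
Qed.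

(** Brings a phase into the range where [acos] inverts [cos]. The sign [e] and the integer [n] are
    kept so that shifts of the phase can be carried along. *)
Lemma angle_fold (x : R) :
  exists (e : R) (n : Z), (e = 1 \/ e = -1) /\ 0 <= e * (x + 2 * PI * IZR n) <= PI.
Proof.
pose proof PI_RGT_0 as Hpi.
set (y := (x + PI) / (2 * PI)).
pose proof (base_Int_part y) as [H1 H2].
assert (Hy : 2 * PI * y = x + PI) by (unfold y; field; lra).
assert (H3 : 2 * PI * IZR (Int_part y) <= 2 * PI * y) by (apply Rmult_le_compat_l; lra).
assert (H4 : 2 * PI * (y - 1) < 2 * PI * IZR (Int_part y)) by (apply Rmult_lt_compat_l; lra).
destruct (Rle_lt_dec 0 (x + 2 * PI * IZR (- Int_part y))) as [H|H];
  [exists 1|exists (-1)]; exists (- Int_part y)%Z; rewrite opp_IZR in *;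
  (split; [tauto|nra]).
Qed.

Lemma cos_fold (e x : R) : e = 1 \/ e = -1 -> cos (e * x) = cos x.
Proof.
intros [->| ->]; [f_equal; ring|].
rewrite <- (cos_neg x); f_equal; ring.
Qed.

Lemma sin_fold (e x : R) : e = 1 \/ e = -1 -> sin (e * x) = e * sin x.
Proof.
intros [->| ->]; [rewrite !Rmult_1_l; trivial|].
replace (-1 * x) with (- x) by ring; rewrite sin_neg; ring.
Qed.

Lemma polar_upper (x y : R) :
  0 <= y -> exists r be : R,
    0 <= r /\ 0 <= be <= PI /\ r ^ 2 = x ^ 2 + y ^ 2 /\ r * cos be = x /\ r * sin be = y.
Proof.
intros Hy.
pose proof PI_RGT_0 as Hpi.
pose proof (pow2_ge_0 x) as Hx2; pose proof (pow2_ge_0 y) as Hy2.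
set (r := sqrt (x ^ 2 + y ^ 2)).
assert (Hr : r ^ 2 = x ^ 2 + y ^ 2) by (unfold r; rewrite <- Rsqr_pow2; apply Rsqr_sqrt; lra).
assert (Hr0 : 0 <= r) by apply sqrt_pos.
destruct (Req_dec r 0) as [H0|H0].
- assert (x ^ 2 + y ^ 2 = 0) by (rewrite <- Hr, H0; ring).
  assert (x = 0) by (apply Rsqr_0_uniq; rewrite Rsqr_pow2; lra).
  assert (y = 0) by (apply Rsqr_0_uniq; rewrite Rsqr_pow2; lra).
  exists r, 0; rewrite H0 in *; repeat split; lra.
- assert (Hrp : 0 < r) by lra.
  assert (Hb : -1 <= x / r <= 1).
  { assert (- r <= x <= r) by (split; nra).
    assert (E : x = x / r * r) by (field; lra). split; nra. }
  exists r, (acos (x / r)).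
  pose proof (acos_bound (x / r)) as Hac.
  assert (Hc : r * cos (acos (x / r)) = x) by (rewrite cos_acos by lra; field; lra).
  repeat split; try lra.
  assert (Hs : 0 <= sin (acos (x / r))) by (apply sin_ge_0; lra).
  pose proof (sin2_cos2 (acos (x / r))) as E; unfold Rsqr in E.
  apply Rsqr_inj; [nra|lra|].
  unfold Rsqr. nra.
Qed.

Lemma polar_exists (x y : R) :
  exists r be : R, 0 <= r /\ r ^ 2 = x ^ 2 + y ^ 2 /\ r * cos be = x /\ r * sin be = y.
Proof.
destruct (Rle_lt_dec 0 y) as [Hy|Hy].
- destruct (polar_upper x y Hy) as [r [be H]]; exists r, be; tauto.
- destruct (polar_upper x (- y) ltac:(lra)) as [r [be [H1 [_ [H2 [H3 H4]]]]]].
  exists r, (- be); rewrite cos_neg, sin_neg.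
  repeat split; try lra; rewrite H2; ring.
Qed.

(** Real and imaginary parts of [(cos tau + i s sin tau) exp(i chi)]: the first coordinate of a
    round geodesic followed by a rotation [chi] of the fibre. The Berger geodesic has
    [chi = tau * eta * s]. *)
Definition zre (s tau chi : R) : R := cos tau * cos chi - s * sin tau * sin chi.
Definition zim (s tau chi : R) : R := cos tau * sin chi + s * sin tau * cos chi.

Lemma zre_polar (s tau chi r be : R) :
  r * cos be = cos tau -> r * sin be = s * sin tau -> zre s tau chi = r * cos (be + chi).
Proof. intros H1 H2; unfold zre; rewrite cos_plus, <- H1, <- H2; ring. Qed.

Lemma zim_polar (s tau chi r be : R) :
  r * cos be = cos tau -> r * sin be = s * sin tau -> zim s tau chi = r * sin (be + chi).
Proof. intros H1 H2; unfold zim; rewrite sin_plus, <- H1, <- H2; ring. Qed.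

Lemma polar_modulus (s tau r : R) :
  -1 <= s <= 1 -> 0 <= r -> r ^ 2 = cos tau ^ 2 + (s * sin tau) ^ 2 -> r <= 1.
Proof.
intros Hs Hr E.
pose proof (sin2_cos2 tau) as E2; rewrite !Rsqr_pow2 in E2.
pose proof (pow2_ge_0 (sin tau)). assert (s ^ 2 <= 1) by nra. nra.
Qed.

Lemma polar_modulus_of_eqs (x y r be : R) :
  r * cos be = x -> r * sin be = y -> r ^ 2 = x ^ 2 + y ^ 2.
Proof.
intros H1 H2; pose proof (sin2_cos2 be) as E; rewrite !Rsqr_pow2 in E.
rewrite <- H1, <- H2. replace (r ^ 2) with (r ^ 2 * (sin be ^ 2 + cos be ^ 2)) by (rewrite E; ring).
ring.
Qed.

(* The argument of [cos t + i s sin t] grows at least at rate [s] for [t] in [[0, PI]]. *)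
Lemma polar_angle_increase (s t1 t2 r1 r2 b1 b2 : R) :
  0 < s <= 1 -> 0 <= t1 <= t2 -> t2 <= PI ->
  0 <= r1 -> r1 * cos b1 = cos t1 -> r1 * sin b1 = s * sin t1 ->
  0 <= r2 -> r2 * cos b2 = cos t2 -> r2 * sin b2 = s * sin t2 ->
  0 <= b1 -> b1 + s * (t2 - t1) <= PI -> 0 <= b2 <= PI ->
  b1 + s * (t2 - t1) <= b2.
Proof.
intros Hs Ht Ht2 Hr1 C1 S1 Hr2 C2 S2 Hb1 Hx Hb2.
set (x := b1 + s * (t2 - t1)).
(* Imaginary part of [(cos t + i s sin t) exp(- i (b1 + s (t - t1)))] at [t = t2]. It vanishes at
   [t1] and its derivative is nonnegative, so the point never falls behind a ray turning at rate
   [s]. *)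
assert (Hh : 0 <= s * sin t2 * cos x - cos t2 * sin x).
{ pose proof (nondecreasing_of_derive
    (fun t => s * sin t * cos (b1 + s * (t - t1)) - cos t * sin (b1 + s * (t - t1)))
    (fun t => (1 - s ^ 2) * sin t * sin (b1 + s * (t - t1))) t1 t2) as H.
  cbv beta in H.
  replace (b1 + s * (t1 - t1)) with b1 in H by ring.
  replace (s * sin t1 * cos b1 - cos t1 * sin b1) with 0 in H by (rewrite <- C1, <- S1; ring).
  apply H; [lra| |].
  - intros t _; auto_derive; [trivial|].
    replace (t + - t1) with (t - t1) by ring. ring.
  - intros t Htt. apply Rmult_le_pos; [apply Rmult_le_pos|]; [nra| |].
    + apply sin_ge_0; lra.
    + assert (0 <= s * (t - t1)) by (apply Rmult_le_pos; lra).
      assert (s * (t - t1) <= s * (t2 - t1)) by (apply Rmult_le_compat_l; lra).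
      apply sin_ge_0; lra. }
assert (Hh2 : 0 <= r2 * sin (b2 - x)).
{ rewrite sin_minus. replace (r2 * (sin b2 * cos x - cos b2 * sin x))
    with (r2 * sin b2 * cos x - r2 * cos b2 * sin x) by ring. now rewrite C2, S2. }
assert (Hx0 : 0 <= x) by (unfold x; nra).
change (x <= PI) in Hx.
destruct (Rle_lt_dec x b2) as [|Hlt]; [assumption|exfalso].
assert (E2 : 0 < r2).
{ destruct Hr2 as [|E]; [assumption|exfalso]. rewrite <- E in *.
  assert (sin t2 = 0) by (apply (Rmult_eq_reg_l s); lra). assert (cos t2 = 0) by lra.
  pose proof (sin2_cos2 t2) as F; unfold Rsqr in F; nra. }
(* With [b2 < x] in [[0, PI]], the sine of [b2 - x] can be nonnegative only at [- PI], that is for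
   [b2 = 0] and [x = PI]. *)
destruct (Req_dec (b2 - x) (- PI)) as [E|E].
- assert (b2 = 0) by lra. assert (x = PI) by lra. subst b2.
  rewrite sin_0 in S2; rewrite cos_0 in C2.
  assert (sin t2 = 0) by (apply (Rmult_eq_reg_l s); lra).
  assert (t2 = 0).
  { destruct (Req_dec t2 PI) as [->|Hn]; [rewrite cos_PI in C2; lra|].
    destruct (Req_dec t2 0) as [|Hn0]; [assumption|].
    pose proof (sin_gt_0 t2); lra. }
  assert (t1 = 0) by lra. subst t1 t2.
  assert (b1 = PI) by (unfold x in *; lra). subst b1.
  rewrite cos_PI, cos_0 in C1; lra.
- assert (0 < sin (x - b2)) by (apply sin_gt_0; lra).
  replace (b2 - x) with (- (x - b2)) in Hh2 by ring. rewrite sin_neg in Hh2. nra.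
Qed.

Lemma polar_angle_ge (s t r b : R) :
  0 <= s <= 1 -> 0 <= t <= PI ->
  0 <= r -> r * cos b = cos t -> r * sin b = s * sin t -> 0 <= b <= PI -> s * t <= b.
Proof.
intros Hs Ht Hr C S Hb.
destruct (Req_dec s 0) as [->|Hn]; [lra|].
pose proof (polar_angle_increase s 0 t 1 r 0 b) as H.
rewrite cos_0, sin_0 in H.
enough (0 + s * (t - 0) <= b) by lra.
apply H; try lra. nra.
Qed.

(** The reflection [t -> PI - t], [b -> PI - b] turns the estimate from the end [0] into one from
    the end [PI]. *)
Lemma polar_angle_le (s t r b : R) :
  0 <= s <= 1 -> 0 <= t <= PI ->
  0 <= r -> r * cos b = cos t -> r * sin b = s * sin t -> 0 <= b <= PI ->
  s * (PI - t) <= PI - b.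
Proof.
intros Hs Ht Hr C S Hb.
assert (Ec : forall x, cos (PI - x) = - cos x) by (intro x; rewrite cos_minus, cos_PI, sin_PI; ring).
assert (Es : forall x, sin (PI - x) = sin x) by (intro x; rewrite sin_minus, cos_PI, sin_PI; ring).
apply (polar_angle_ge s (PI - t) r (PI - b)); rewrite ?Ec, ?Es; lra.
Qed.

Lemma le_acos (x y : R) : -1 <= x <= 1 -> 0 <= y <= PI -> x <= cos y -> y <= acos x.
Proof.
intros Hx Hy H. apply le_of_cos_le; [assumption|apply acos_bound|].
now rewrite cos_acos.
Qed.

Lemma radius_cos_bound (r x : R) : 0 <= r <= 1 -> -1 <= r * cos x <= 1.
Proof. intros Hr; pose proof (COS_bound x); nra. Qed.

(** The [acos] of the real part is the round distance to the identity; turning the phase away from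
    [0] within [[0, PI]] increases it. *)
Lemma acos_radius_ge (r b b' tau : R) :
  0 <= r <= 1 -> 0 <= tau <= PI -> r * cos b = cos tau -> 0 <= b -> b <= b' <= PI ->
  tau <= acos (r * cos b').
Proof.
intros Hr Ht C Hb Hb'.
apply le_acos; [now apply radius_cos_bound|assumption|].
rewrite <- C. apply Rmult_le_compat_l; [lra|].
apply cos_decr_1; lra.
Qed.

(** * Lower bound for the cost *)

Lemma cos_concave (x y : R) :
  0 <= x <= PI / 2 -> 0 <= y <= PI / 2 -> sin x * (y - x) <= cos x - cos y.
Proof.
intros Hx Hy.
pose proof (nondecreasing_of_derive (fun t => - cos t - sin x * t)
  (fun t => sin t - sin x) x y) as H1.
pose proof (nondecreasing_of_derive (fun t => cos t + sin x * t)
  (fun t => sin x - sin t) y x) as H2.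
cbv beta in H1, H2.
destruct (Rle_lt_dec x y) as [H|H].
- enough (- cos x - sin x * x <= - cos y - sin x * y) by lra.
  apply H1; [assumption| |].
  + intros t _; auto_derive; [trivial|ring].
  + intros t Ht; enough (sin x <= sin t) by lra; apply sin_incr_1; lra.
- enough (cos y + sin x * y <= cos x + sin x * x) by lra.
  apply H2; [lra| |].
  + intros t _; auto_derive; [trivial|ring].
  + intros t Ht; enough (sin t <= sin x) by lra; apply sin_incr_1; lra.
Qed.

(** A tangent line at [be] to the squared round distance as a function of the phase; its slope is
    [2 * tau * s] because [r * sin be = s * sin tau]. It stays below the graph by concavity of [cos]
    on [[0, PI / 2]] together with convexity of [cos (sqrt x)]. *)
Lemma acos_radius_sq_convex (s tau r be be' : R) :
  0 <= r <= 1 -> 0 < tau < PI -> r * cos be = cos tau -> r * sin be = s * sin tau ->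
  0 <= be <= PI / 2 -> 0 <= be' <= PI / 2 ->
  tau ^ 2 + 2 * (tau * s) * (be' - be) <= acos (r * cos be') ^ 2.
Proof.
intros Hr Ht C S Hb Hb'.
set (sg := acos (r * cos be')).
assert (Hs : cos sg = r * cos be') by (apply cos_acos, radius_cos_bound, Hr).
pose proof (cos_tangent_sq tau sg ltac:(lra)) as H.
pose proof (cos_concave be be' Hb Hb') as H2.
assert (Hst : 0 < sin tau) by (apply sin_gt_0; lra).
assert (H3 : r * (sin be * (be' - be)) <= r * (cos be - cos be')) by (apply Rmult_le_compat_l; lra).
assert (H4 : s * sin tau * (be' - be) <= sin tau / (2 * tau) * (sg ^ 2 - tau ^ 2)).
{ rewrite <- S, Rmult_assoc. lra. }
assert (H5 : sin tau * (s * (be' - be)) <= sin tau * ((sg ^ 2 - tau ^ 2) / (2 * tau))).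
{ replace (sin tau * (s * (be' - be))) with (s * sin tau * (be' - be)) by ring.
  replace (sin tau * ((sg ^ 2 - tau ^ 2) / (2 * tau)))
    with (sin tau / (2 * tau) * (sg ^ 2 - tau ^ 2)) by (field; lra). exact H4. }
apply Rmult_le_reg_l in H5; [|assumption].
assert (H6 : 2 * tau * (s * (be' - be)) <= 2 * tau * ((sg ^ 2 - tau ^ 2) / (2 * tau)))
  by (apply Rmult_le_compat_l; lra).
replace (2 * tau * ((sg ^ 2 - tau ^ 2) / (2 * tau))) with (sg ^ 2 - tau ^ 2) in H6 by (field; lra).
lra.
Qed.

(** Here [kap] stands for [tau * s]. The choice [psi = b - D] turns the phase into [be' = th - D].
    It is at least [be], hence at round distance at least [tau], and completing the square in [b]
    costs only [D ^ 2 / eta], which [eta * kap <= D <= 0] controls. The geodesic itself has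
    [D = eta * kap] and [b = (1 + eta) * kap], and equality throughout. *)
Lemma cost_lower_bound_neg (eta r be tau kap th a b : R) :
  -1 < eta < 0 -> 0 <= r <= 1 -> 0 <= tau <= PI -> r * cos be = cos tau ->
  0 <= be <= PI -> 0 <= kap -> be + eta * kap <= th <= PI ->
  (forall psi, acos (r * cos (th + psi - b)) ^ 2 <= a ^ 2 + psi ^ 2) ->
  tau ^ 2 + eta * kap ^ 2 <= a ^ 2 + b ^ 2 / (1 + eta).
Proof.
intros He Hr Ht C Hb Hk Hth H.
(* The natural value of [th - be'] is [eta * kap]; [be'] is capped at [PI] when this would carry it
   further. *)
assert (HE : exists be', be <= be' <= PI /\ eta * kap <= th - be' <= 0).
{ destruct (Rle_lt_dec (th - eta * kap) PI) as [H1|H1].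
  - exists (th - eta * kap); nra.
  - exists PI; lra. }
destruct HE as [be' [H1 H2]].
specialize (H (be' - th + b)).
replace (th + (be' - th + b) - b) with be' in H by ring.
pose proof (acos_radius_ge r be be' tau Hr Ht C (proj1 Hb) H1) as H3.
pose proof (sq_le tau _ (conj (proj1 Ht) H3)) as H4.
set (D := th - be') in *.
assert (HD : eta * kap ^ 2 <= D ^ 2 / eta).
{ apply (Rmult_le_reg_l (- eta)); [lra|].
  replace (- eta * (D ^ 2 / eta)) with (- D ^ 2) by (field; lra). nra. }
assert (HQ : D ^ 2 / eta <= b ^ 2 / (1 + eta) - (b - D) ^ 2).
{ assert (E : b ^ 2 / (1 + eta) - (b - D) ^ 2 - D ^ 2 / eta =
    (- eta) / (1 + eta) * (b - D * (1 + eta) / eta) ^ 2) by (field; lra).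
  assert (0 <= (- eta) / (1 + eta) * (b - D * (1 + eta) / eta) ^ 2).
  { apply Rmult_le_pos; [|apply pow2_ge_0]. apply Rlt_le, Rdiv_lt_0_compat; lra. }
  lra. }
replace (be' - th + b) with (b - D) in H by (unfold D; ring).
lra.
Qed.

(** Here [psi] cannot absorb all of [b]. The displacement is first put into the phase [al], which it
    lowers by at most [Rabs b]; the tangent line then makes this loss linear in [Rabs b], and the
    weighted inequality [Hsq] between a product and two squares pays for it. *)
Lemma cost_lower_bound_nonneg (eta s r be tau al a b : R) :
  0 <= eta -> 0 <= s -> 0 <= r <= 1 -> 0 < tau < PI ->
  r * cos be = cos tau -> r * sin be = s * sin tau ->
  0 <= be -> be + eta * (tau * s) <= PI / 2 ->
  0 <= al <= PI -> be + eta * (tau * s) - Rabs b <= al ->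
  (forall psi, acos (r * cos (al + psi)) ^ 2 <= a ^ 2 + psi ^ 2) ->
  tau ^ 2 + eta * (tau * s) ^ 2 <= a ^ 2 + b ^ 2 / (1 + eta).
Proof.
intros He Hs Hr Ht C S Hb Hth Hal Hab H.
assert (Hk : 0 <= tau * s) by (apply Rmult_le_pos; lra).
assert (HQ := fun x => acos_radius_sq_convex s tau r be x Hr Ht C S).
set (kap := tau * s) in *.
assert (Hek : 0 <= eta * kap) by (apply Rmult_le_pos; lra).
assert (Hbe : 0 <= be <= PI / 2) by lra.
assert (EB : b ^ 2 = Rabs b ^ 2) by (rewrite <- !Rsqr_pow2; apply Rsqr_abs).
rewrite EB. assert (HB : 0 <= Rabs b) by apply Rabs_pos.
set (B := Rabs b) in *; clearbody B; clear EB.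
assert (HBe : 0 <= B ^ 2 / (1 + eta)).
{ apply Rmult_le_pos; [apply pow2_ge_0|]. apply Rlt_le, Rinv_0_lt_compat; lra. }
assert (Hsq : forall x, 2 * x * B <= (1 + eta) * x ^ 2 + B ^ 2 / (1 + eta)).
{ intro x. assert (E : (1 + eta) * x ^ 2 + B ^ 2 / (1 + eta) - 2 * x * B =
    / (1 + eta) * ((1 + eta) * x - B) ^ 2) by (field; lra).
  assert (0 <= / (1 + eta) * ((1 + eta) * x - B) ^ 2).
  { apply Rmult_le_pos; [|apply pow2_ge_0]. apply Rlt_le, Rinv_0_lt_compat; lra. }
  lra. }
(* The spread of the geodesic is [psi = kap]. If it would carry the phase out of [[0, PI / 2]],
   where the tangent line is available, the phase is moved to [PI / 2] only, or left in place when
   it is already beyond. *)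
destruct (Rle_lt_dec (al + kap) (PI / 2)) as [H1|H1].
- specialize (H kap). specialize (HQ (al + kap) Hbe ltac:(lra)).
  specialize (Hsq kap).
  assert (kap * (eta * kap - B) <= kap * (al - be)) by (apply Rmult_le_compat_l; lra).
  lra.
- specialize (HQ (PI / 2) Hbe ltac:(lra)).
  assert (H2 : kap * (eta * kap) <= kap * (PI / 2 - be)) by (apply Rmult_le_compat_l; lra).
  destruct (Rle_lt_dec al (PI / 2)) as [H3|H3].
  + specialize (H (PI / 2 - al)). replace (al + (PI / 2 - al)) with (PI / 2) in H by ring.
    set (x := PI / 2 - al) in *.
    assert (Hx : 0 <= x <= kap) by (unfold x; lra).
    assert (Hx2 : x ^ 2 <= kap ^ 2) by (apply sq_le; lra).
    assert (Hex : eta * x ^ 2 <= eta * kap ^ 2) by (apply Rmult_le_compat_l; lra).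
    destruct (Rle_lt_dec x B) as [H4|H4].
    * specialize (Hsq x).
      assert (x * x <= x * B) by (apply Rmult_le_compat_l; lra).
      lra.
    * specialize (Hsq x).
      assert (kap * (x - B + eta * kap) <= kap * (PI / 2 - be)).
      { apply Rmult_le_compat_l; [lra|]. unfold x; lra. }
      assert (x * (x - B) <= kap * (x - B)) by (apply Rmult_le_compat_r; lra).
      lra.
  + specialize (H 0). rewrite Rplus_0_r in H.
    assert (H5 : acos (r * cos (PI / 2)) <= acos (r * cos al)).
    { apply (acos_radius_ge r (PI / 2)); try lra.
      - apply acos_bound.
      - symmetry; apply cos_acos, radius_cos_bound, Hr. }
    pose proof (acos_bound (r * cos (PI / 2))) as H6.
    pose proof (sq_le _ _ (conj (proj1 H6) H5)).
    assert (0 <= kap * (eta * kap)) by (apply Rmult_le_pos; lra).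
    lra.
Qed.

(* [a] and [b] are half the horizontal length and half the fibre displacement of a curve
   ending at the [j]-th translate of the point of parameters [(tau, s)]. *)
Definition minimal_cost (eta : R) (p : Z) (s tau : R) : Prop :=
  forall (a b : R) (j : Z),
    (forall psi, acos (zre s tau (tau * eta * s + 2 * PI * IZR j / IZR p + psi - b)) ^ 2
       <= a ^ 2 + psi ^ 2) ->
    tau ^ 2 * (1 + eta * s ^ 2) <= a ^ 2 + b ^ 2 / (1 + eta).

Lemma PI_div_bound (P : R) : 2 <= P -> 0 < PI / P <= PI / 2.
Proof.
intros HP; pose proof PI_RGT_0. split; [apply Rdiv_lt_0_compat; lra|].
apply Rmult_le_compat_l; [lra|]. apply Rinv_le_contravar; lra.
Qed.

(** For [eta < 0] the phase is at least [(1 + eta) * s * tau], since [be >= s * tau]. For [eta >= 0]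
    both summands are at most [PI / 2]. *)
Lemma sector_angle (eta : R) (p : Z) (s tau r be : R) :
  -1 < eta -> (2 <= p)%Z -> 0 <= s <= 1 -> 0 < tau < PI ->
  0 < r -> r * cos be = cos tau -> r * sin be = s * sin tau -> 0 <= be <= PI ->
  (0 <= eta -> tau <= PI / 2 /\ tau * eta * s <= PI / IZR p) ->
  0 <= be + eta * (tau * s) <= PI.
Proof.
intros He Hp Hs Ht Hr C S Hb Hpos.
apply IZR_le in Hp. pose proof (PI_div_bound _ Hp) as HP.
assert (0 <= tau * s) by (apply Rmult_le_pos; lra).
destruct (Rle_lt_dec 0 eta) as [H0|H0].
- destruct (Hpos H0) as [H1 H2].
  assert (be <= PI / 2).
  { destruct (Rle_lt_dec be (PI / 2)) as [|Hlt]; [assumption|].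
    assert (0 <= cos tau) by (apply cos_ge_0; lra).
    assert (cos be < 0) by (apply cos_lt_0; lra). nra. }
  assert (0 <= eta * (tau * s)) by (apply Rmult_le_pos; lra).
  lra.
- pose proof (polar_angle_ge s tau r be Hs ltac:(lra) ltac:(lra) C S Hb). nra.
Qed.

(** A negative [ell] puts the phase [th0] of the endpoint in [[0, PI / p)]. The phases of the
    translates are [th0 + 2 k PI / p], and none of them is closer to [0], so each one folds to some
    [th >= th0]; this is what both lower bounds require. *)
Lemma minimal_cost_pos (eta : R) (p : Z) (s tau : R) :
  -1 < eta -> (2 <= p)%Z -> 0 <= s <= 1 -> 0 < tau < PI ->
  ell eta p (-1) tau s < 0 ->
  (0 <= eta -> tau <= PI / 2 /\ tau * eta * s <= PI / IZR p) ->
  minimal_cost eta p s tau.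
Proof.
intros He Hp Hs Ht Hell Hpos a b j H.
assert (Hst : 0 < sin tau) by (apply sin_gt_0; lra).
destruct (polar_upper (cos tau) (s * sin tau)) as [r [be [Hr [Hb [Hr2 [C S]]]]]].
{ apply Rmult_le_pos; lra. }
assert (Hr1 : r <= 1) by (apply (polar_modulus s tau); lra).
assert (Hp' := IZR_le _ _ Hp). pose proof (PI_div_bound _ Hp') as HP.
assert (Hell' : r * sin (be + (tau * eta * s + -1 * PI / IZR p)) < 0)
  by (rewrite <- (zim_polar s tau _ r be C S); exact Hell).
assert (Hr0 : 0 < r) by (destruct Hr as [|E]; [assumption|rewrite <- E in Hell'; lra]).
pose proof (sector_angle eta p s tau r be He Hp Hs Ht Hr0 C S Hb Hpos) as Hth.
assert (Hk : 0 <= tau * s) by (apply Rmult_le_pos; lra).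
assert (HthP : be + eta * (tau * s) < PI / IZR p).
{ destruct (Rlt_le_dec (be + eta * (tau * s)) (PI / IZR p)) as [|Hge]; [assumption|].
  assert (0 <= sin (be + (tau * eta * s + -1 * PI / IZR p))).
  { replace (be + (tau * eta * s + -1 * PI / IZR p))
      with (be + eta * (tau * s) - PI / IZR p) by (field; lra).
    apply sin_ge_0; lra. }
  nra. }
set (th0 := be + eta * (tau * s)) in *.
destruct (angle_fold (th0 + 2 * PI * IZR j / IZR p)) as [e [n [Hee Hth1]]].
set (th := e * (th0 + 2 * PI * IZR j / IZR p + 2 * PI * IZR n)) in *.
assert (Hge : th0 <= th).
{ assert (E : th = e * (th0 + IZR (2 * (j + n * p)) * (PI / IZR p))).
  { unfold th; rewrite mult_IZR, plus_IZR, mult_IZR; field; lra. }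
  rewrite E in *. clear E.
  set (k := (j + n * p)%Z) in *; rewrite mult_IZR in *.
  destruct (Z_le_dec 1 k) as [Hk1|Hk1]; [apply IZR_le in Hk1|
  destruct (Z_le_dec k (-1)) as [Hk2|Hk2]; [apply IZR_le in Hk2|
    assert (Ek : k = 0%Z) by lia; rewrite Ek in *]];
  destruct Hee as [-> | ->]; nra. }
assert (He2 : e * e = 1) by (destruct Hee as [-> | ->]; ring).
assert (HC : forall psi, acos (r * cos (th + psi - e * b)) ^ 2 <= a ^ 2 + psi ^ 2).
{ intro psi. specialize (H (e * psi)).
  rewrite (zre_polar s tau _ r be C S) in H.
  replace ((e * psi) ^ 2) with ((e * e) * psi ^ 2) in H by ring. rewrite He2, Rmult_1_l in H.
  replace (th + psi - e * b) with
    (e * (be + (tau * eta * s + 2 * PI * IZR j / IZR p + e * psi - b) + 2 * PI * IZR n)).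
  - now rewrite cos_fold, cos_2PI_IZR.
  - unfold th, th0. ring_simplify. replace (e ^ 2) with 1 by lra. ring. }
replace (b ^ 2) with ((e * b) ^ 2) by (replace ((e * b) ^ 2) with ((e * e) * b ^ 2) by ring; rewrite He2; ring).
set (b' := e * b) in *. clearbody b'; clear H.
replace (tau ^ 2 * (1 + eta * s ^ 2)) with (tau ^ 2 + eta * (tau * s) ^ 2) by ring.
destruct (Rlt_le_dec eta 0) as [H0|H0].
- apply (cost_lower_bound_neg eta r be tau (tau * s) th a b'); try lra; [change (th0 <= th <= PI); lra|exact HC].
- destruct (angle_fold (th - b')) as [e' [n' [Hee' Hal]]].
  set (al := e' * (th - b' + 2 * PI * IZR n')) in *.
  apply (cost_lower_bound_nonneg eta s r be tau al); try lra; try assumption.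
  + change (th0 <= PI / 2); lra.
  + change (th0 - Rabs b' <= al).
    pose proof (Rle_abs b'); pose proof (Rle_abs (- b')); rewrite Rabs_Ropp in *.
    unfold al in *.
    destruct (Z_le_dec 1 n') as [Hk1|Hk1]; [apply IZR_le in Hk1|
    destruct (Z_le_dec n' (-1)) as [Hk2|Hk2]; [apply IZR_le in Hk2|
      assert (Ek : n' = 0%Z) by lia; rewrite Ek in *]];
    destruct Hee' as [-> | ->]; nra.
  + intro psi. specialize (HC (e' * psi)).
    assert (He3 : e' * e' = 1) by (destruct Hee' as [-> | ->]; ring).
    replace ((e' * psi) ^ 2) with ((e' * e') * psi ^ 2) in HC by ring. rewrite He3, Rmult_1_l in HC.
    replace (al + psi) with (e' * (th + e' * psi - b' + 2 * PI * IZR n')).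
    * now rewrite cos_fold, cos_2PI_IZR.
    * unfold al. ring_simplify. replace (e' ^ 2) with 1 by lra. ring.
Qed.

(** * Cheaper competitors *)

Lemma minimal_cost_opp (eta : R) (p : Z) (s tau : R) :
  minimal_cost eta p (- s) tau -> minimal_cost eta p s tau.
Proof.
intros H a b j Hc.
replace (s ^ 2) with ((- s) ^ 2) by ring; replace (b ^ 2) with ((- b) ^ 2) by ring.
apply (H a (- b) (- j)%Z). intro psi. specialize (Hc (- psi)).
replace ((- psi) ^ 2) with (psi ^ 2) in Hc by ring.
replace (zre (- s) tau (tau * eta * - s + 2 * PI * IZR (- j) / IZR p + psi - - b))
  with (zre s tau (tau * eta * s + 2 * PI * IZR j / IZR p + - psi - b)); [exact Hc|].
rewrite opp_IZR; unfold zre.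
replace (tau * eta * - s + 2 * PI * - IZR j / IZR p + psi - - b)
  with (- (tau * eta * s + 2 * PI * IZR j / IZR p + - psi - b)) by (unfold Rdiv; ring).
rewrite cos_neg, sin_neg; ring.
Qed.

(* Some point of the fibre is reached more cheaply, by a round geodesic of parameters
   [(sg, u)] twisted uniformly along the Hopf fibre. *)
Definition improvable_cost (eta : R) (p : Z) (s tau : R) : Prop :=
  exists (sg u b : R) (j : Z),
    -1 <= u <= 1 /\
    zre u sg (b - sg * u) = zre s tau (tau * eta * s + 2 * PI * IZR j / IZR p) /\
    zim u sg (b - sg * u) = zim s tau (tau * eta * s + 2 * PI * IZR j / IZR p) /\
    sg ^ 2 * (1 - u ^ 2) + b ^ 2 / (1 + eta) < tau ^ 2 * (1 + eta * s ^ 2).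

Lemma zre_opp (s tau chi : R) : zre (- s) tau (- chi) = zre s tau chi.
Proof. unfold zre; rewrite cos_neg, sin_neg; ring. Qed.

Lemma zim_opp (s tau chi : R) : zim (- s) tau (- chi) = - zim s tau chi.
Proof. unfold zim; rewrite cos_neg, sin_neg; ring. Qed.

Lemma improvable_cost_opp (eta : R) (p : Z) (s tau : R) :
  improvable_cost eta p (- s) tau -> improvable_cost eta p s tau.
Proof.
intros [sg [u [b [j [Hu [H1 [H2 H3]]]]]]].
exists sg, (- u), (- b), (- j)%Z.
replace ((- u) ^ 2) with (u ^ 2) by ring; replace ((- b) ^ 2) with (b ^ 2) by ring.
replace ((- s) ^ 2) with (s ^ 2) in H3 by ring.
replace (- b - sg * - u) with (- (b - sg * u)) by ring.
replace (tau * eta * s + 2 * PI * IZR (- j) / IZR p)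
  with (- (tau * eta * - s + 2 * PI * IZR j / IZR p)) by (rewrite opp_IZR; unfold Rdiv; ring).
rewrite zre_opp, zim_opp, H1, H2.
pose proof (zre_opp (- s) tau (tau * eta * - s + 2 * PI * IZR j / IZR p)) as E1.
pose proof (zim_opp (- s) tau (tau * eta * - s + 2 * PI * IZR j / IZR p)) as E2.
rewrite Ropp_involutive in E1, E2.
repeat split; lra.
Qed.

(** * Circles of the base with prescribed holonomy *)

Lemma continuity_pt_acos (x : R) : -1 < x < 1 -> continuity_pt acos x.
Proof. intros H; apply derivable_continuous_pt, derivable_pt_acos, H. Qed.

(* Among the circles of the base through the base point, one reaches a point at the
   distance prescribed by [r] with the prescribed holonomy [al]. *)
Lemma circle_with_holonomy (r al : R) :
  0 <= r <= 1 -> 0 <= al <= PI ->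
  exists sg u be : R, 0 <= sg <= PI /\ 0 <= u <= 1 /\ 0 <= be <= PI /\
    cos sg = r * cos be /\ u * sin sg = r * sin be /\ al = be - sg * u.
Proof.
intros Hr Hal. pose proof PI_RGT_0 as Hpi.
destruct (Req_dec r 1) as [->|Hr1].
(* For [r = 1] the endpoint lies in the fibre of the base point and the formula for [u] below can
   degenerate. Full circles, [sg = PI], are closed for every [u] and realize every holonomy
   [PI - PI * u]. *)
- exists PI, (1 - al / PI), PI.
  assert (E : PI * (al / PI) = al) by (field; lra).
  assert (0 <= al / PI <= 1) by (split; nra).
  rewrite sin_PI. repeat split; lra.
- assert (Hc : forall x, -1 < r * cos x < 1) by (intro x; pose proof (COS_bound x); nra).
  (* The holonomy [be - sg * u] as a function of the phase [be]; it equals [0] at [0] and [PI] at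
     [PI]. *)
  set (f := fun x => x - acos (r * cos x) * (r * sin x / sqrt (1 - (r * cos x) ^ 2))).
  assert (Hf : continuity f).
  { intro x. specialize (Hc x).
    assert (Hcos : continuity_pt (fun x => r * cos x) x) by reg.
    apply continuity_pt_minus; [reg|]. apply continuity_pt_mult.
    - apply (continuity_pt_comp (fun x => r * cos x) acos); [assumption|].
      now apply continuity_pt_acos.
    - assert (H0 : 0 < 1 - (r * cos x) ^ 2) by nra.
      apply continuity_pt_div; [reg| |].
      + apply (continuity_pt_comp (fun x => 1 - (r * cos x) ^ 2) sqrt); [reg|].
        apply continuity_pt_sqrt; lra.
      + apply Rgt_not_eq, sqrt_lt_R0, H0. }
  destruct (IVT_gen f 0 PI al Hf) as [be [Hb E]].
  { unfold f. rewrite sin_0, sin_PI. unfold Rdiv. rewrite !Rmult_0_r, !Rmult_0_l, !Rmult_0_r, !Rminus_0_r.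
    rewrite Rmin_left, Rmax_right by lra. lra. }
  rewrite Rmin_left, Rmax_right in Hb by lra.
  specialize (Hc be).
  set (sg := acos (r * cos be)).
  assert (Hcs : cos sg = r * cos be) by (apply cos_acos; lra).
  assert (Hss : sin sg = sqrt (1 - (r * cos be) ^ 2)).
  { unfold sg; rewrite sin_acos by lra. now rewrite Rsqr_pow2. }
  assert (H0 : 0 < sqrt (1 - (r * cos be) ^ 2)) by (apply sqrt_lt_R0; nra).
  assert (Hsb : 0 <= r * sin be) by (apply Rmult_le_pos; [lra|apply sin_ge_0; lra]).
  exists sg, (r * sin be / sqrt (1 - (r * cos be) ^ 2)), be.
  split; [apply acos_bound|].
  assert (Hu : 0 <= r * sin be / sqrt (1 - (r * cos be) ^ 2)).
  { apply Rmult_le_pos; [assumption|]. apply Rlt_le, Rinv_0_lt_compat, H0. }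
  assert (Eu : r * sin be / sqrt (1 - (r * cos be) ^ 2) * sin sg = r * sin be)
    by (rewrite Hss; field; lra).
  repeat split; try assumption; try lra.
  + apply (Rmult_le_reg_r (sin sg)); [lra|]. rewrite Eu, Rmult_1_l, Hss.
    rewrite <- (sqrt_Rsqr (r * sin be)) by assumption. apply sqrt_le_1_alt.
    pose proof (sin2_cos2 be) as F; unfold Rsqr in *. nra.
  + rewrite <- E; reflexivity.
Qed.

(** Undoes the folding of the holonomy: the sign [e] passes to [u], which replaces the circle by its
    mirror image. *)
Lemma circle_endpoint (r ah al e b sg u be : R) (n : Z) :
  e = 1 \/ e = -1 -> ah = e * (al + 2 * PI * IZR n) ->
  cos sg = r * cos be -> u * sin sg = r * sin be -> ah = be - sg * u ->
  zre (e * u) sg (b - sg * (e * u)) = r * cos (al + b) /\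
  zim (e * u) sg (b - sg * (e * u)) = r * sin (al + b).
Proof.
intros He Ea C S Eh.
assert (C' : r * cos (e * be) = cos sg) by (rewrite cos_fold; auto).
assert (S' : r * sin (e * be) = e * u * sin sg).
{ rewrite sin_fold by assumption. replace (e * u * sin sg) with (e * (u * sin sg)) by ring.
  rewrite S; ring. }
rewrite (zre_polar _ _ _ r (e * be) C' S'), (zim_polar _ _ _ r (e * be) C' S').
replace (e * be + (b - sg * (e * u))) with (al + b + 2 * PI * IZR n).
- now rewrite cos_2PI_IZR, sin_2PI_IZR.
- assert (He2 : e * e = 1) by (destruct He as [-> | ->]; ring).
  assert (e * ah = al + 2 * PI * IZR n).
  { rewrite Ea. replace (e * (e * (al + 2 * PI * IZR n))) with (e * e * (al + 2 * PI * IZR n)) by ring.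
    rewrite He2; ring. }
  rewrite Eh in H. lra.
Qed.

(** The geodesic runs along the fibre. A full circle of the base with [u = 1 - v] contributes
    holonomy [PI * v], which is saved on the displacement. The first-order gain in the cost is
    [PI * v * K], positive exactly beyond [PI], against a term quadratic in [v]. *)
Lemma improvable_fibre (eta : R) (p : Z) (tau : R) :
  -1 < eta -> PI < tau -> improvable_cost eta p 1 tau.
Proof.
intros He Ht. pose proof PI_RGT_0 as Hpi.
set (K := 2 * (tau - PI)).
assert (HK : 0 < K) by (unfold K; lra).
(* [D] exceeds both [K] and [PI * (/ (1 + eta) - 1)], so [v = K / D] is below [1] and small enough
   for the linear gain to win. *)
set (D := PI * (1 + / (1 + eta)) + K).
assert (Hi : 0 < / (1 + eta)) by (apply Rinv_0_lt_compat; lra).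
assert (HD : K < D).
{ unfold D. assert (0 < PI * (1 + / (1 + eta))) by (apply Rmult_lt_0_compat; lra). lra. }
set (v := K / D).
assert (Hv : v * D = K) by (unfold v; field; lra).
assert (Hv0 : 0 < v) by (apply Rdiv_lt_0_compat; lra).
assert (Hv1 : v < 1) by nra.
exists PI, (1 - v), (tau * (1 + eta) - PI * v), 0%Z.
split; [lra|].
replace (tau * eta * 1 + 2 * PI * 0 / IZR p) with (tau * eta) by (unfold Rdiv; ring).
replace (tau * (1 + eta) - PI * v - PI * (1 - v)) with (tau + tau * eta - PI) by ring.
unfold zre, zim. rewrite cos_PI, sin_PI.
rewrite (cos_minus _ PI), (sin_minus _ PI), cos_PI, sin_PI, cos_plus, sin_plus.
repeat split; try ring.
assert (E : PI ^ 2 * (1 - (1 - v) ^ 2) + (tau * (1 + eta) - PI * v) ^ 2 / (1 + eta) =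
  tau ^ 2 * (1 + eta * 1 ^ 2) - PI * v * (K - PI * v * (/ (1 + eta) - 1))).
{ unfold K; field; lra. }
rewrite E.
assert (0 < PI * v) by (apply Rmult_lt_0_compat; lra).
assert (PI * v * (/ (1 + eta) - 1) < K).
{ rewrite <- Hv. unfold D. replace (PI * v * (/ (1 + eta) - 1)) with (v * (PI * (/ (1 + eta) - 1))) by ring.
  apply Rmult_lt_compat_l; lra. }
assert (0 < PI * v * (K - PI * v * (/ (1 + eta) - 1))) by (apply Rmult_lt_0_compat; lra).
lra.
Qed.

(** The competitor keeps the fibre displacement and, up to folding, the holonomy, so only the
    horizontal cost must drop. Equal holonomies give [del = tau * s - e * (sg * u)], and the strict
    comparison of sides then reads [sg^2 (1 - u^2) < tau^2 (1 - s^2)]. *)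
Lemma improvable_long (eta : R) (p : Z) (s tau : R) :
  -1 < eta -> 0 <= s < 1 -> PI < tau -> improvable_cost eta p s tau.
Proof.
intros He Hs Ht.
destruct (polar_exists (cos tau) (s * sin tau)) as [r [be [Hr [Hr2 [C S]]]]].
assert (Hr1 : r <= 1) by (apply (polar_modulus s tau); lra).
destruct (angle_fold (be - tau * s)) as [e [n [Hee Hah]]].
set (ah := e * (be - tau * s + 2 * PI * IZR n)) in *.
destruct (circle_with_holonomy r ah (conj Hr Hr1) Hah) as [sg [u [b1 [Hsg [Hu [Hb1 [C1 [S1 E1]]]]]]]].
exists sg, (e * u), (tau * s * (1 + eta)), 0%Z.
assert (He2 : e ^ 2 = 1) by (destruct Hee as [-> | ->]; ring).
split; [destruct Hee as [-> | ->]; lra|].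
destruct (circle_endpoint r ah (be - tau * s) e (tau * s * (1 + eta)) sg u b1 n Hee eq_refl C1 S1 E1)
  as [F1 F2].
rewrite F1, F2, (zre_polar _ _ _ r be C S), (zim_polar _ _ _ r be C S).
replace (be + (tau * eta * s + 2 * PI * 0 / IZR p)) with (be - tau * s + tau * s * (1 + eta))
  by (unfold Rdiv; ring).
repeat split.
set (be' := e * b1 - 2 * PI * IZR n).
assert (Hc : cos sg = cos tau * cos (be - be') + s * sin tau * sin (be - be')).
{ rewrite C1, <- C, <- S.
  replace (r * cos be * cos (be - be') + r * sin be * sin (be - be'))
    with (r * (cos be * cos (be - be') + sin be * sin (be - be'))) by ring.
  rewrite <- cos_minus. replace (be - (be - be')) with (e * b1 + 2 * PI * IZR (- n))
    by (unfold be'; rewrite opp_IZR; ring).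
  now rewrite cos_2PI_IZR, cos_fold. }
pose proof (spherical_side_lt s tau (be - be') sg ltac:(lra) Ht Hsg Hc) as H.
assert (Ed : be - be' = tau * s - e * (sg * u)).
{ unfold be'. assert (e * ah = be - tau * s + 2 * PI * IZR n).
  { unfold ah. replace (e * (e * (be - tau * s + 2 * PI * IZR n))) with (e ^ 2 * (be - tau * s + 2 * PI * IZR n)) by ring.
    rewrite He2; ring. }
  rewrite E1 in H0. lra. }
rewrite Ed in H.
assert (E3 : (tau * s * (1 + eta)) ^ 2 / (1 + eta) = (tau * s) ^ 2 * (1 + eta)) by (field; lra).
rewrite E3.
replace ((e * u) ^ 2) with (e ^ 2 * u ^ 2) by ring. rewrite He2.
replace (tau ^ 2 - 2 * tau * s * (tau * s - e * (sg * u)) + (tau * s - e * (sg * u)) ^ 2)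
  with (tau ^ 2 - (tau * s) ^ 2 + e ^ 2 * (sg * u) ^ 2) in H by ring.
rewrite He2 in H. lra.
Qed.

(** The comparison passes through a phase [b2 >= b1]. Moving to it does not decrease the round
    distance [sg], and the comparison of sides with [del = be - b2] bounds the square of the new
    distance by [tau^2 (1 - s^2) + (b2 - al)^2], where [b2 - al <= sg * u]. *)
Lemma circle_monotone (s tau r be ah sg u b1 : R) :
  0 <= s <= 1 -> 0 <= tau <= PI ->
  0 <= r <= 1 -> r * cos be = cos tau -> r * sin be = s * sin tau ->
  0 <= be - tau * s <= PI -> 0 <= ah <= be - tau * s ->
  0 <= sg <= PI -> 0 <= u <= 1 -> 0 <= b1 <= PI -> cos sg = r * cos b1 -> ah = b1 - sg * u ->
  sg ^ 2 * (1 - u ^ 2) <= tau ^ 2 * (1 - s ^ 2).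
Proof.
intros Hs Ht Hr C S Hal Hah Hsg Hu Hb1 C1 E1.
set (al := be - tau * s) in *.
assert (Hsu : 0 <= sg * u) by (apply Rmult_le_pos; lra).
assert (HE : exists b2, b1 <= b2 <= PI /\ 0 <= b2 - al <= sg * u).
{ destruct (Rle_lt_dec (b1 + al - ah) PI) as [H1|H1].
  - exists (b1 + al - ah); lra.
  - exists PI; lra. }
destruct HE as [b2 [H1 H2]].
set (s2 := acos (r * cos b2)).
assert (H3 : sg <= s2) by (apply (acos_radius_ge r b1); lra).
assert (Hs2 : 0 <= s2 <= PI) by apply acos_bound.
assert (Hc : cos s2 = cos tau * cos (be - b2) + s * sin tau * sin (be - b2)).
{ unfold s2; rewrite cos_acos by (now apply radius_cos_bound).
  rewrite <- C, <- S.
  replace (r * cos be * cos (be - b2) + r * sin be * sin (be - b2))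
    with (r * (cos be * cos (be - b2) + sin be * sin (be - b2))) by ring.
  rewrite <- cos_minus. do 2 f_equal; ring. }
pose proof (spherical_side_le s tau (be - b2) s2 ltac:(lra) Hs2 Hc) as H4.
pose proof (sq_le sg s2 ltac:(lra)).
pose proof (sq_le (b2 - al) (sg * u) ltac:(lra)).
replace (tau ^ 2 - 2 * tau * s * (be - b2) + (be - b2) ^ 2)
  with (tau ^ 2 - (tau * s) ^ 2 + (b2 - al) ^ 2) in H4 by (unfold al; ring).
lra.
Qed.

(** The phase of the endpoint is the sum of the holonomy [be - tau * s] of its circle and the
    displacement [b0]. Aiming at the translate [j = -1] lowers this sum by [2 PI / p]. If the
    holonomy is below [PI / p], the mirror image reaches that translate with a displacement strictly
    between [- b0] and [b0]. Otherwise the displacement drops by [d] and the holonomy takes the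
    rest, without growing in absolute value. *)
Lemma improvable_short (eta : R) (p : Z) (s tau r be : R) :
  -1 < eta -> (2 <= p)%Z -> 0 < s <= 1 -> 0 < tau <= PI ->
  0 <= r -> r * cos be = cos tau -> r * sin be = s * sin tau -> 0 <= be <= PI ->
  PI / IZR p < be + eta * (tau * s) -> improvable_cost eta p s tau.
Proof.
intros He Hp Hs Ht Hr C S Hb Hth.
assert (Hp' := IZR_le _ _ Hp). pose proof (PI_div_bound _ Hp') as HP.
pose proof (polar_modulus_of_eqs _ _ r be C S) as Hr2.
assert (Hr1 : r <= 1) by (apply (polar_modulus s tau); lra).
pose proof (polar_angle_ge s tau r be ltac:(lra) ltac:(lra) Hr C S Hb) as Hge.
assert (Hk : 0 < tau * s) by (apply Rmult_lt_0_compat; lra).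
set (P := IZR p) in *.
set (b0 := tau * s * (1 + eta)).
assert (Hb0 : 0 < b0) by (apply Rmult_lt_0_compat; lra).
assert (Ecost : tau ^ 2 * (1 + eta * s ^ 2) = tau ^ 2 * (1 - s ^ 2) + b0 ^ 2 / (1 + eta))
  by (unfold b0; field; lra).
assert (Hinv : 0 < / (1 + eta)) by (apply Rinv_0_lt_compat; lra).
assert (Hcmp : forall x, - b0 < x < b0 -> x ^ 2 / (1 + eta) < b0 ^ 2 / (1 + eta)).
{ intros x Hx; apply Rmult_lt_compat_r; [assumption|nra]. }
assert (Eang : be + (tau * eta * s + 2 * PI * -1 / P) = be + eta * (tau * s) - 2 * (PI / P))
  by (field; lra).
destruct (Rlt_le_dec (be - tau * s) (PI / P)) as [H1|H1].
- exists tau, (- s), (be + eta * (tau * s) - 2 * (PI / P) + (be - tau * s)), (-1)%Z.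
  split; [lra|].
  assert (C' : r * cos (- be) = cos tau) by (rewrite cos_neg; exact C).
  assert (S' : r * sin (- be) = - s * sin tau) by (rewrite sin_neg; lra).
  rewrite (zre_polar _ _ _ r _ C' S'), (zim_polar _ _ _ r _ C' S').
  rewrite (zre_polar _ _ _ r _ C S), (zim_polar _ _ _ r _ C S); fold P; rewrite Eang.
  replace (- be + (be + eta * (tau * s) - 2 * (PI / P) + (be - tau * s) - tau * - s))
    with (be + eta * (tau * s) - 2 * (PI / P)) by ring.
  repeat split.
  rewrite Ecost. replace ((- s) ^ 2) with (s ^ 2) by ring.
  apply Rplus_lt_compat_l, Hcmp. unfold b0 in *. lra.
(* From [0 < d <= b0] the displacement [b0 - d] is strictly cheaper; [d <= PI / P] and
   [be - tau * s >= PI / P] keep [Rabs al] at most [be - tau * s]. *)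
- set (d := Rmin b0 (PI / P)).
  assert (Hd : 0 < d /\ d <= b0 /\ d <= PI / P).
  { repeat split; [apply Rmin_glb_lt; lra|apply Rmin_l|apply Rmin_r]. }
  set (al := be - tau * s - 2 * (PI / P) + d).
  assert (HE : exists e, (e = 1 \/ e = -1) /\ 0 <= e * (al + 2 * PI * IZR 0) <= be - tau * s).
  { destruct (Rle_lt_dec 0 al); [exists 1|exists (-1)]; (split; [tauto|]); unfold al in *; lra. }
  destruct HE as [e [Hee Hah]].
  set (ah := e * (al + 2 * PI * IZR 0)) in *.
  destruct (circle_with_holonomy r ah) as [sg [u [b1 [Hsg [Hu [Hb1 [C1 [S1 E1]]]]]]]]; [lra|lra|].
  exists sg, (e * u), (b0 - d), (-1)%Z.
  assert (He2 : e ^ 2 = 1) by (destruct Hee as [-> | ->]; ring).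
  split; [destruct Hee as [-> | ->]; lra|].
  destruct (circle_endpoint r ah al e (b0 - d) sg u b1 0 Hee eq_refl C1 S1 E1) as [F1 F2].
  rewrite F1, F2, (zre_polar _ _ _ r be C S), (zim_polar _ _ _ r be C S); fold P; rewrite Eang.
  replace (al + (b0 - d)) with (be + eta * (tau * s) - 2 * (PI / P)) by (unfold al, b0; ring).
  repeat split.
  rewrite Ecost. replace ((e * u) ^ 2) with (e ^ 2 * u ^ 2) by ring. rewrite He2, Rmult_1_l.
  apply Rplus_le_lt_compat.
  + apply (circle_monotone s tau r be ah sg u b1); lra.
  + apply Hcmp; lra.
Qed.

(** At [s = 0] there is no displacement to save, so the gain must be horizontal: the holonomy [PI]
    of the geodesic becomes [PI - 2 PI / p]. The new cost is [sg^2 - (sg u)^2] with [sg <= tau]; if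
    [sg * u = 0], then [b1 = ah < PI] forces [sg < tau]. *)
Lemma improvable_equator (eta : R) (p : Z) (tau : R) :
  -1 < eta -> (2 <= p)%Z -> PI / 2 < tau <= PI -> improvable_cost eta p 0 tau.
Proof.
intros He Hp Ht.
assert (Hp' := IZR_le _ _ Hp). pose proof (PI_div_bound _ Hp') as HP.
assert (Hc0 : cos tau < 0) by (apply cos_lt_0; lra).
set (r := - cos tau).
assert (Hr : 0 < r <= 1) by (pose proof (COS_bound tau); unfold r; lra).
set (ah := PI - 2 * (PI / IZR p)).
assert (Hah : 0 <= ah < PI) by (unfold ah; lra).
destruct (circle_with_holonomy r ah) as [sg [u [b1 [Hsg [Hu [Hb1 [C1 [S1 E1]]]]]]]]; [lra|lra|].
exists sg, (1 * u), 0, (-1)%Z.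
split; [lra|].
destruct (circle_endpoint r ah ah 1 0 sg u b1 0 (or_introl eq_refl) ltac:(simpl; ring) C1 S1 E1)
  as [F1 F2].
assert (C : r * cos PI = cos tau) by (rewrite cos_PI; unfold r; ring).
assert (S : r * sin PI = 0 * sin tau) by (rewrite sin_PI; ring).
rewrite F1, F2, (zre_polar _ _ _ r _ C S), (zim_polar _ _ _ r _ C S).
replace (PI + (tau * eta * 0 + 2 * PI * -1 / IZR p)) with (ah + 0) by (unfold ah; field; lra).
repeat split.
replace (tau ^ 2 * (1 + eta * 0 ^ 2)) with (tau ^ 2) by ring.
replace (sg ^ 2 * (1 - (1 * u) ^ 2) + 0 ^ 2 / (1 + eta)) with (sg ^ 2 - (sg * u) ^ 2) by (field; lra).
assert (Hle : sg <= tau).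
{ apply le_of_cos_le; [lra|lra|]. rewrite C1.
  pose proof (COS_bound b1). unfold r in *. nra. }
assert (Hsu : 0 <= sg * u) by (apply Rmult_le_pos; lra).
destruct Hsu as [Hsu|Hsu].
- pose proof (sq_le sg tau ltac:(lra)). assert (0 < (sg * u) ^ 2) by nra. lra.
- rewrite <- Hsu in *. enough (sg ^ 2 < tau ^ 2) by lra.
  apply sq_lt. split; [lra|]. apply lt_of_cos_lt; [lra|lra|].
  rewrite C1. assert (cos PI < cos b1) by (apply cos_decreasing_1; lra).
  rewrite cos_PI in *. unfold r in *. nra.
Qed.

(** * First positive roots of a continuous function *)

Lemma first_pos_root_exists (f : R -> R) (x : R) :
  continuity f -> f 0 < 0 -> 0 < x -> 0 <= f x -> exists t, first_pos_root f t.
Proof.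
intros Hf H0 Hx Hfx.
set (E := fun t => 0 <= t <= x /\ forall u, 0 <= u <= t -> f u < 0).
assert (HE0 : E 0).
{ split; [lra|]. intros u Hu; replace u with 0 by lra; assumption. }
destruct (completeness E) as [m [Hub Hlub]].
{ exists x; intros t [Ht _]; lra. }
{ exists 0; exact HE0. }
assert (Hm0 : 0 <= m) by (apply Hub, HE0).
assert (Hmx : m <= x) by (apply Hlub; intros t [Ht _]; lra).
assert (Hbelow : forall u, 0 <= u < m -> f u < 0).
{ intros u Hu. destruct (Rlt_le_dec (f u) 0) as [|Hge]; [assumption|exfalso].
  assert (m <= u); [|lra]. apply Hlub. intros t [Ht1 Ht2].
  destruct (Rle_lt_dec t u) as [|Hlt]; [assumption|]. specialize (Ht2 u); lra. }
assert (Hnb : forall c, f m <> 0 -> c = Rabs (f m) ->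
  exists d, 0 < d /\ forall u, Rabs (u - m) < d -> Rabs (f u - f m) < c).
{ intros c Hn Hc. pose proof (proj1 (continuity_pt_locally f m) (Hf m)) as H.
  assert (Hcp : 0 < c) by (rewrite Hc; now apply Rabs_pos_lt).
  destruct (H (mkposreal c Hcp)) as [d Hd].
  exists d; split; [apply cond_pos|]. intros u Hu; apply Hd, Hu. }
assert (Hfm : f m = 0).
{ destruct (Req_dec (f m) 0) as [|Hn]; [assumption|exfalso].
  destruct (Hnb _ Hn eq_refl) as [d [Hd Hd']].
  destruct (Rlt_le_dec (f m) 0) as [Hneg|Hpos].
  - assert (Hlt : m < x) by (destruct (Req_dec m x) as [Em|]; [subst; lra|lra]).
    set (t := Rmin x (m + d / 2)).
    assert (Ht : m < t) by (apply Rmin_glb_lt; lra).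
    assert (Ht2 : t <= x /\ t <= m + d / 2) by (split; [apply Rmin_l|apply Rmin_r]).
    enough (E t) by (pose proof (Hub t H); lra).
    split; [lra|]. intros u Hu.
    destruct (Rlt_le_dec u m) as [|Hu2]; [apply Hbelow; lra|].
    assert (Hu3 : Rabs (u - m) < d) by (apply Rabs_def1; lra).
    specialize (Hd' u Hu3). rewrite (Rabs_left (f m)) in Hd' by lra.
    apply Rabs_def2 in Hd'; lra.
  - assert (Hm : 0 < m) by (destruct Hm0 as [|Em]; [assumption|subst m; lra]).
    set (u := Rmax 0 (m - d / 2)).
    assert (Hu : u < m) by (apply Rmax_lub_lt; lra).
    assert (Hu2 : 0 <= u /\ m - d / 2 <= u) by (split; [apply Rmax_l|apply Rmax_r]).
    assert (Hu3 : Rabs (u - m) < d) by (apply Rabs_def1; lra).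
    specialize (Hd' u Hu3). rewrite (Rabs_right (f m)) in Hd' by lra.
    apply Rabs_def2 in Hd'. specialize (Hbelow u); lra. }
exists m. repeat split; [|assumption|].
- destruct Hm0 as [|Em]; [assumption|subst m; lra].
- intros t Ht. specialize (Hbelow t); lra.
Qed.

Lemma neg_before_first_root (f : R -> R) (m t : R) :
  continuity f -> f 0 < 0 -> first_pos_root f m -> 0 <= t < m -> f t < 0.
Proof.
intros Hf H0 [Hm [_ Hn]] Ht.
destruct (Rlt_le_dec (f t) 0) as [|Hge]; [assumption|exfalso].
destruct (Req_dec t 0) as [->|Hn0]; [lra|].
assert (f t <> 0) by (apply Hn; lra).
destruct (IVT f 0 t Hf) as [z [Hz Hz0]]; try lra.
destruct (Req_dec z 0) as [->|Hz1]; [lra|].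
apply (Hn z); lra.
Qed.

Lemma first_root_le (f : R -> R) (m x : R) :
  continuity f -> f 0 < 0 -> first_pos_root f m -> 0 < x -> 0 <= f x -> m <= x.
Proof.
intros Hf H0 Hm Hx Hfx. destruct (Rle_lt_dec m x) as [|Hlt]; [assumption|].
pose proof (neg_before_first_root f m x Hf H0 Hm); lra.
Qed.

(** * First roots *)

Lemma ell_zim (eta : R) (p : Z) (sg tau s : R) :
  ell eta p sg tau s = zim s tau (tau * eta * s + sg * PI / IZR p).
Proof. reflexivity. Qed.

Lemma ell_continuity (eta : R) (p : Z) (sg s : R) : continuity (fun t => ell eta p sg t s).
Proof. unfold ell; reg. Qed.

Lemma ell_0 (eta : R) (p : Z) (sg s : R) : ell eta p sg 0 s = sin (sg * PI / IZR p).
Proof. unfold ell; rewrite cos_0, sin_0, !Rmult_0_l, Rplus_0_l; ring. Qed.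

Lemma ell_half_turns (eta : R) (p : Z) (sg tau s : R) :
  sin tau = 0 -> ell eta p sg tau s = sin (tau * (1 + eta * s) + sg * PI / IZR p).
Proof.
intros H. unfold ell.
replace (tau * (1 + eta * s) + sg * PI / IZR p) with (tau + (tau * eta * s + sg * PI / IZR p)) by ring.
rewrite (sin_plus tau), H; ring.
Qed.

(** Multiples of [PI] scaled by [d] advance by [PI * d], so one falls in any window of that length.
    With [d = 1 + eta * s <= 1] the window fits into a half period of the sine in
    [ell_half_turns]. *)
Lemma half_turns_below (d y : R) :
  0 < d -> 0 <= y -> exists t, 0 < t /\ sin t = 0 /\ PI * y < t * d <= PI * y + PI * d.
Proof.
intros Hd Hy. pose proof PI_RGT_0 as Hpi.
pose proof (archimed (y / d)) as [H1 H2].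
set (k := IZR (up (y / d))) in *.
assert (E : y = y / d * d) by (field; lra).
assert (0 <= y / d) by (apply Rmult_le_pos; [lra|apply Rlt_le, Rinv_0_lt_compat, Hd]).
assert (H3 : y < k * d <= y + d) by (split; nra).
exists (k * PI). split; [apply Rmult_lt_0_compat; lra|].
split; [apply sin_eq_0_1; exists (up (y / d)); reflexivity|].
replace (k * PI * d) with (PI * (k * d)) by ring.
rewrite <- Rmult_plus_distr_l. split.
- apply Rmult_lt_compat_l; lra.
- apply Rmult_le_compat_l; lra.
Qed.

(** Supplies the bounds on [tau] and [tau * eta * s] that [minimal_cost_pos] requires for
    [eta >= 0]. The witness is [PI / 2] if the twist there is at most [PI / p], and otherwise the
    point where the twist equals [PI / p] and [ell] reduces to [s * sin x]. *)
Lemma ell_minus_nonneg_early (eta : R) (p : Z) (s : R) :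
  0 <= eta -> (2 <= p)%Z -> 0 <= s <= 1 ->
  exists x, 0 < x <= PI / 2 /\ x * eta * s <= PI / IZR p /\ 0 <= ell eta p (-1) x s.
Proof.
intros He Hp Hs.
assert (Hp' := IZR_le _ _ Hp). pose proof (PI_div_bound _ Hp') as HP.
assert (Hes : 0 <= eta * s) by (apply Rmult_le_pos; lra).
destruct (Rle_lt_dec (PI / 2 * eta * s) (PI / IZR p)) as [H|H].
- exists (PI / 2). repeat split; try lra.
  unfold ell. rewrite cos_PI2, sin_PI2, Rmult_0_l, Rplus_0_l, Rmult_1_r.
  apply Rmult_le_pos; [lra|].
  assert (0 <= PI / 2 * eta * s) by (rewrite Rmult_assoc; apply Rmult_le_pos; lra).
  replace (-1 * PI / IZR p) with (- (PI / IZR p)) by (field; lra).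
  apply cos_ge_0; lra.
- assert (Hes' : 0 < eta * s) by (destruct Hes as [|E]; [assumption|rewrite Rmult_assoc, <- E in H; lra]).
  set (x := PI / IZR p / (eta * s)).
  assert (Ex : x * eta * s = PI / IZR p).
  { unfold x. rewrite Rmult_assoc. set (es := eta * s) in *. field; lra. }
  assert (Hx : 0 < x) by (apply Rdiv_lt_0_compat; lra).
  assert (Hx2 : x <= PI / 2).
  { rewrite <- Ex in H. rewrite !Rmult_assoc in H. apply Rmult_lt_reg_r in H; lra. }
  exists x. repeat split; try lra.
  unfold ell. rewrite Ex. replace (PI / IZR p + -1 * PI / IZR p) with 0 by (field; lra).
  rewrite sin_0, cos_0. pose proof (sin_ge_0 x ltac:(lra) ltac:(lra)). nra.
Qed.

Lemma ell_plus_nonpos (eta : R) (p : Z) (s : R) :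
  0 <= eta -> (2 <= p)%Z -> 0 <= s <= 1 -> exists x, 0 < x /\ ell eta p 1 x s <= 0.
Proof.
intros He Hp Hs.
assert (Hp' := IZR_le _ _ Hp). pose proof (PI_div_bound _ Hp') as HP.
assert (Hes : 0 <= eta * s) by (apply Rmult_le_pos; lra).
assert (Hy0 : 0 <= PI / 2 * (eta * s)) by (apply Rmult_le_pos; lra).
assert (EP : 1 * PI / IZR p = PI / IZR p) by (field; lra).
(* The witness depends on the shifted twist at [PI / 2]: if it is at least [PI], the point where it
   equals [PI]; if it lies in [[PI / 2, PI)], the point [PI / 2]; if it is smaller, the point
   [PI]. *)
destruct (Rle_lt_dec PI (PI / 2 * (eta * s) + PI / IZR p)) as [H|H];
[|destruct (Rle_lt_dec (PI / 2) (PI / 2 * (eta * s) + PI / IZR p)) as [H'|H']].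
- assert (Hes' : 0 < eta * s) by (destruct Hes as [|E]; [assumption|rewrite <- E in H; lra]).
  set (x := (PI - PI / IZR p) / (eta * s)).
  assert (Ex : x * (eta * s) = PI - PI / IZR p) by (unfold x; set (es := eta * s) in *; field; lra).
  assert (Hx : 0 < x) by (apply Rdiv_lt_0_compat; lra).
  assert (Hx2 : x <= PI / 2).
  { apply (Rmult_le_reg_r (eta * s)); [assumption|]. rewrite Ex; lra. }
  exists x; split; [lra|]. unfold ell. rewrite EP, Rmult_assoc, Ex.
  replace (PI - PI / IZR p + PI / IZR p) with PI by ring.
  rewrite sin_PI, cos_PI. pose proof (sin_ge_0 x ltac:(lra) ltac:(lra)). nra.
- exists (PI / 2); split; [lra|]. unfold ell.
  rewrite cos_PI2, sin_PI2, EP, Rmult_assoc.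
  assert (cos (PI / 2 * (eta * s) + PI / IZR p) <= 0) by (apply cos_le_0; lra).
  nra.
- exists PI; split; [lra|]. rewrite ell_half_turns by apply sin_PI.
  rewrite EP. apply sin_le_0; lra.
Qed.

Lemma opp_first_pos_root (f : R -> R) (m : R) :
  first_pos_root (fun t => - f t) m -> first_pos_root f m.
Proof.
intros [H1 [H2 H3]]. repeat split; [assumption|lra|].
intros t Ht E; apply (H3 t Ht); lra.
Qed.

Lemma first_pos_root_opp (f : R -> R) (m : R) :
  first_pos_root f m -> first_pos_root (fun t => - f t) m.
Proof.
intros [H1 [H2 H3]]. repeat split; [assumption|lra|].
intros t Ht E; apply (H3 t Ht); lra.
Qed.

(** The cut point in the parameter [tau], where the metric enters through [eta] alone. Nothing is
    asked at [tau = T], the cut time being a supremum. *)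
Definition cut_parameter (eta : R) (p : Z) (s T : R) : Prop :=
  (forall tau, 0 < tau < T -> minimal_cost eta p s tau) /\
  (forall tau, T < tau -> improvable_cost eta p s tau).

Lemma first_roots_exist (eta : R) (p : Z) (s : R) :
  -1 < eta -> (2 <= p)%Z -> 0 <= s <= 1 ->
  exists tm tp, first_pos_root (fun t => ell eta p (-1) t s) tm /\
    first_pos_root (fun t => ell eta p 1 t s) tp.
Proof.
intros He Hp Hs.
assert (Hp' := IZR_le _ _ Hp). pose proof (PI_div_bound _ Hp') as HP.
pose proof PI_RGT_0 as Hpi.
assert (EM : -1 * PI / IZR p = - (PI / IZR p)) by (field; lra).
assert (EP : 1 * PI / IZR p = PI / IZR p) by (field; lra).
assert (Hsin : 0 < sin (PI / IZR p)) by (apply sin_gt_0; lra).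
assert (HX : (exists x, 0 < x /\ 0 <= ell eta p (-1) x s) /\ (exists x, 0 < x /\ ell eta p 1 x s <= 0)).
{ destruct (Rle_lt_dec 0 eta) as [H0|H0].
  - split; [|now apply ell_plus_nonpos].
    destruct (ell_minus_nonneg_early eta p s H0 Hp Hs) as [x [Hx [_ H]]]; exists x; split; [lra|assumption].
  - assert (Hd : 0 < 1 + eta * s <= 1) by nra.
    assert (Hi : 0 <= / IZR p <= 1).
    { split; [apply Rlt_le, Rinv_0_lt_compat; lra|]. rewrite <- Rinv_1. apply Rinv_le_contravar; lra. }
    assert (Hpd : PI * (1 + eta * s) <= PI) by nra.
    split.
    + destruct (half_turns_below (1 + eta * s) (/ IZR p)) as [x [Hx [Hx0 Hx1]]]; [lra|lra|].
      exists x; split; [assumption|]. rewrite ell_half_turns, EM by assumption.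
      unfold Rdiv; apply sin_ge_0; lra.
    + destruct (half_turns_below (1 + eta * s) (1 - / IZR p)) as [x [Hx [Hx0 Hx1]]]; [lra|lra|].
      exists x; split; [assumption|]. rewrite ell_half_turns, EP by assumption.
      unfold Rdiv; apply sin_le_0; lra. }
destruct HX as [[x [Hx Hx']] [y [Hy Hy']]].
destruct (first_pos_root_exists (fun t => ell eta p (-1) t s) x) as [tm Htm];
  [apply ell_continuity|rewrite ell_0, EM, sin_neg; lra|assumption|assumption|].
destruct (first_pos_root_exists (fun t => - ell eta p 1 t s) y) as [tp Htp];
  [apply continuity_opp, ell_continuity|rewrite ell_0, EP; lra|assumption|lra|].
exists tm, tp. split; [assumption|]. now apply opp_first_pos_root.
Qed.

(** All three claims follow the phase [be + eta * tau * s]. It stays below [PI / p] before the first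
    root, is at least [PI / p] at a root before [PI], and from there grows at rate at least
    [(1 + eta) * s]. Its value at [PI] decides whether the root comes before or after [PI]. *)
Lemma cut_parameter_nonneg (eta : R) (p : Z) (s tm tp : R) :
  -1 < eta -> (2 <= p)%Z -> 0 <= s <= 1 ->
  first_pos_root (fun t => ell eta p (-1) t s) tm ->
  first_pos_root (fun t => ell eta p 1 t s) tp ->
  cut_parameter eta p s (Rmin PI (Rmin tm tp)) /\
  (- ((IZR p - 1) / IZR p) <= eta * s -> Rmin tm tp <= PI) /\
  (eta * s <= - ((IZR p - 1) / IZR p) -> PI <= Rmin tm tp).
Proof.
intros He Hp Hs Htm Htp.
assert (Hp' := IZR_le _ _ Hp). pose proof (PI_div_bound _ Hp') as HP.
pose proof PI_RGT_0 as Hpi.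
assert (EM : -1 * PI / IZR p = - (PI / IZR p)) by (field; lra).
assert (EP : 1 * PI / IZR p = PI / IZR p) by (field; lra).
assert (Hsin : 0 < sin (PI / IZR p)) by (apply sin_gt_0; lra).
assert (Hm0 : ell eta p (-1) 0 s < 0) by (rewrite ell_0, EM, sin_neg; lra).
assert (Hcm := ell_continuity eta p (-1) s).
assert (Hl : Rmin tm tp <= tm /\ Rmin tm tp <= tp) by (split; [apply Rmin_l|apply Rmin_r]).
assert (Hearly : 0 <= eta -> tm <= PI / 2 /\ forall t, 0 <= t <= tm -> t * eta * s <= PI / IZR p).
{ intros H0. destruct (ell_minus_nonneg_early eta p s H0 Hp Hs) as [x [Hx [Hx1 Hx2]]].
  pose proof (first_root_le _ tm x Hcm Hm0 Htm (proj1 Hx) Hx2) as Hle.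
  split; [lra|]. intros t Ht. apply Rle_trans with (x * eta * s); [|assumption].
  rewrite !Rmult_assoc. apply Rmult_le_compat_r; [apply Rmult_le_pos|]; lra. }
assert (Epm : PI * (- ((IZR p - 1) / IZR p)) = PI / IZR p - PI) by (field; lra).
assert (Hpol : forall t, 0 < t <= PI -> exists r be, 0 <= r /\ 0 <= be <= PI /\
   r * cos be = cos t /\ r * sin be = s * sin t).
{ intros t Ht. destruct (polar_upper (cos t) (s * sin t)) as [r [be H]].
  - apply Rmult_le_pos; [lra|apply sin_ge_0; lra].
  - exists r, be; tauto. }
set (tl := Rmin tm tp) in *.
assert (Htl0 : 0 < tl) by (apply Rmin_glb_lt; [apply Htm|apply Htp]).
assert (Hroot : ell eta p (-1) tl s = 0 \/ ell eta p 1 tl s = 0).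
{ unfold tl, Rmin. destruct (Rle_dec tm tp); [left; apply Htm|right; apply Htp]. }
split; [split|split].
- intros tau Htau.
  assert (Hlt : tau < PI /\ tau < tl).
  { split; apply Rlt_le_trans with (1 := proj2 Htau); [apply Rmin_l|apply Rmin_r]. }
  apply minimal_cost_pos; try lra; try assumption.
  + apply (neg_before_first_root _ tm tau Hcm Hm0 Htm); lra.
  + intros H0. destruct (Hearly H0) as [H1 H2]. split; [lra|apply H2; lra].
- intros tau Htau.
  destruct (Rlt_le_dec PI tau) as [H1|H1].
  { destruct (Req_dec s 1) as [->|Hs1]; [now apply improvable_fibre|].
    apply improvable_long; lra. }
  assert (Htt : tl < tau).
  { unfold Rmin in Htau; destruct (Rle_dec PI tl); lra. }
  destruct (Req_dec s 0) as [Hs0|Hs0].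
  + subst s. apply improvable_equator; try assumption.
    split; [|assumption]. apply Rle_lt_trans with (2 := Htt).
    (* For [s = 0] both functions are multiples of [cos tau] by nonzero constants, so neither
       vanishes before [PI / 2]. *)
    destruct (Rle_lt_dec (PI / 2) tl) as [|Hlt]; [assumption|exfalso].
    assert (Hc : 0 < cos tl) by (apply cos_gt_0; lra).
    unfold ell in Hroot. rewrite !Rmult_0_r, !Rmult_0_l, !Rplus_0_l, !Rplus_0_r, EM, EP, sin_neg in Hroot.
    destruct Hroot; nra.
  + assert (Hst : 0 < sin tl) by (apply sin_gt_0; lra).
    destruct (Hpol tl ltac:(lra)) as [r0 [b0 [Hr0 [Hb0 [C0 S0]]]]].
    destruct (Hpol tau ltac:(lra)) as [r [be [Hr [Hb [C S]]]]].
    assert (Hr0' : 0 < r0).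
    { destruct Hr0 as [|E]; [assumption|]. rewrite <- E in S0.
      assert (0 < s * sin tl) by (apply Rmult_lt_0_compat; lra). lra. }
    pose proof (sector_angle eta p s tl r0 b0 He Hp Hs ltac:(lra) Hr0' C0 S0 Hb0) as Hsec.
    assert (Hth0 : 0 <= b0 + eta * (tl * s) <= PI).
    { apply Hsec. intros H0. destruct (Hearly H0) as [H2 H3].
      split; [lra|apply H3; lra]. }
    (* At a phase in [[0, PI / p)] a shift by [PI / p] either way gives a nonzero sine, so [tl]
       would not be a root. *)
    assert (Hge0 : PI / IZR p <= b0 + eta * (tl * s)).
    { destruct (Rle_lt_dec (PI / IZR p) (b0 + eta * (tl * s))) as [|Hlt]; [assumption|exfalso].
      rewrite !ell_zim, !(zim_polar s tl _ r0 b0 C0 S0), EM, EP in Hroot.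
      replace (b0 + (tl * eta * s + - (PI / IZR p))) with (- (PI / IZR p - (b0 + eta * (tl * s)))) in Hroot by ring.
      replace (b0 + (tl * eta * s + PI / IZR p)) with (b0 + eta * (tl * s) + PI / IZR p) in Hroot by ring.
      rewrite sin_neg in Hroot.
      assert (0 < sin (PI / IZR p - (b0 + eta * (tl * s)))) by (apply sin_gt_0; lra).
      assert (0 < sin (b0 + eta * (tl * s) + PI / IZR p)) by (apply sin_gt_0; lra).
      destruct Hroot; nra. }
    apply (improvable_short eta p s tau r be); try lra; try assumption.
    pose proof (polar_angle_le s tl r0 b0 Hs ltac:(lra) ltac:(lra) C0 S0 Hb0) as Hle0.
    assert (Hinc : b0 + s * (tau - tl) <= be).
    { apply (polar_angle_increase s tl tau r0 r b0 be); try lra.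
      assert (s * (tau - tl) <= s * (PI - tl)) by (apply Rmult_le_compat_l; lra). lra. }
    assert (0 < (1 + eta) * (s * (tau - tl))).
    { apply Rmult_lt_0_compat; [lra|]. apply Rmult_lt_0_compat; lra. }
    lra.
- intros Hes. destruct (Rle_lt_dec 0 eta) as [H0|H0].
  { destruct (Hearly H0); lra. }
  apply Rle_trans with (1 := proj1 Hl).
  apply (first_root_le _ tm PI Hcm Hm0 Htm Hpi).
  rewrite ell_half_turns, EM by apply sin_PI.
  assert (H1 : PI * (- ((IZR p - 1) / IZR p)) <= PI * (eta * s)) by (apply Rmult_le_compat_l; lra).
  assert (H3 : eta * s <= 0) by nra.
  assert (H2 : 0 <= PI * - (eta * s)) by (apply Rmult_le_pos; lra).
  apply sin_ge_0; lra.
- intros Hes.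
  assert (H1 : PI * (eta * s) <= PI * (- ((IZR p - 1) / IZR p))) by (apply Rmult_le_compat_l; lra).
  rewrite Epm in H1.
  assert (Hes0 : eta * s < 0).
  { destruct (Rlt_le_dec (eta * s) 0) as [|Hge]; [assumption|].
    assert (0 <= PI * (eta * s)) by (apply Rmult_le_pos; lra). lra. }
  assert (He0 : eta < 0) by nra. assert (Hs0 : 0 < s) by nra.
  destruct (Rle_lt_dec PI tl) as [|Hlt]; [assumption|exfalso].
  destruct (Hpol tl ltac:(lra)) as [r0 [b0 [Hr0 [Hb0 [C0 S0]]]]].
  assert (Hst : 0 < sin tl) by (apply sin_gt_0; lra).
  assert (Hr0' : 0 < r0).
  { destruct Hr0 as [|E]; [assumption|]. rewrite <- E in S0.
    assert (0 < s * sin tl) by (apply Rmult_lt_0_compat; lra). lra. }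
  pose proof (polar_angle_ge s tl r0 b0 Hs ltac:(lra) ltac:(lra) C0 S0 Hb0) as Hge0.
  pose proof (polar_angle_le s tl r0 b0 Hs ltac:(lra) ltac:(lra) C0 S0 Hb0) as Hle0.
  assert (Hth0 : 0 <= b0 + eta * (tl * s)) by nra.
  (* Estimated from the end [PI]: the phase at [tl] is at most
     [PI (1 + eta s) - (1 + eta) s (PI - tl)]. *)
  assert (Hth1 : b0 + eta * (tl * s) < PI / IZR p).
  { assert (0 < (1 + eta) * (s * (PI - tl))).
    { apply Rmult_lt_0_compat; [lra|]. apply Rmult_lt_0_compat; lra. }
    lra. }
  rewrite !ell_zim, !(zim_polar s tl _ r0 b0 C0 S0), EM, EP in Hroot.
  replace (b0 + (tl * eta * s + - (PI / IZR p))) with (- (PI / IZR p - (b0 + eta * (tl * s)))) in Hroot by ring.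
  replace (b0 + (tl * eta * s + PI / IZR p)) with (b0 + eta * (tl * s) + PI / IZR p) in Hroot by ring.
  rewrite sin_neg in Hroot.
  assert (0 < sin (PI / IZR p - (b0 + eta * (tl * s)))) by (apply sin_gt_0; lra).
  assert (0 < sin (b0 + eta * (tl * s) + PI / IZR p)) by (apply sin_gt_0; lra).
  destruct Hroot; nra.
Qed.

Lemma cut_parameter_opp (eta : R) (p : Z) (s T : R) :
  cut_parameter eta p (- s) T -> cut_parameter eta p s T.
Proof.
intros [H1 H2]; split; intros tau Ht.
- apply minimal_cost_opp, H1, Ht.
- apply improvable_cost_opp, H2, Ht.
Qed.

Lemma ell_opp (eta : R) (p : Z) (sg tau s : R) : ell eta p (- sg) tau (- s) = - ell eta p sg tau s.
Proof.
rewrite !ell_zim.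
replace (tau * eta * - s + - sg * PI / IZR p) with (- (tau * eta * s + sg * PI / IZR p))
  by (unfold Rdiv; ring).
apply zim_opp.
Qed.

Lemma first_pos_root_ext (f g : R -> R) (m : R) :
  (forall t, f t = g t) -> first_pos_root f m -> first_pos_root g m.
Proof.
intros E [H1 [H2 H3]]. repeat split; [assumption|now rewrite <- E|].
intros t Ht; rewrite <- E; now apply H3.
Qed.

Lemma cut_parameter_exists (eta : R) (p : Z) (s : R) :
  -1 < eta -> (2 <= p)%Z -> -1 <= s <= 1 ->
  exists tm tp,
  first_pos_root (fun t => ell eta p (-1) t s) tm /\
  first_pos_root (fun t => ell eta p 1 t s) tp /\
  cut_parameter eta p s (Rmin PI (Rmin tm tp)) /\
  (- ((IZR p - 1) / IZR p) <= eta * Rabs s -> Rmin tm tp <= PI) /\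
  (eta * Rabs s <= - ((IZR p - 1) / IZR p) -> PI <= Rmin tm tp).
Proof.
intros He Hp Hs.
destruct (Rle_lt_dec 0 s) as [H0|H0].
- rewrite Rabs_right by lra.
  destruct (first_roots_exist eta p s He Hp ltac:(lra)) as [tm [tp [Hm Hq]]].
  exists tm, tp. split; [assumption|]. split; [assumption|].
  apply cut_parameter_nonneg; try assumption; lra.
- rewrite Rabs_left by lra.
  destruct (first_roots_exist eta p (- s) He Hp ltac:(lra)) as [tm [tp [Hm Hq]]].
  (* Changing the sign of [s] exchanges the two root functions up to sign, so the roots trade
     places. *)
  exists tp, tm. rewrite (Rmin_comm tp tm).
  destruct (cut_parameter_nonneg eta p (- s) tm tp He Hp ltac:(lra) Hm Hq) as [H1 H2].
  split; [|split; [|split; [now apply cut_parameter_opp|assumption]]].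
  + apply first_pos_root_opp in Hq. revert Hq. apply first_pos_root_ext. intro t.
    rewrite <- ell_opp, Ropp_involutive. f_equal; ring.
  + apply first_pos_root_opp in Hm. revert Hm. apply first_pos_root_ext. intro t.
    rewrite <- ell_opp, Ropp_involutive. f_equal; ring.
Qed.

(** * Length of curves *)

Lemma is_derive_acos (x : R) : -1 < x < 1 -> is_derive acos x (- / sqrt (1 - x ^ 2)).
Proof.
intros Hx. apply is_derive_Reals.
apply derive_pt_eq_1 with (derivable_pt_acos x Hx).
rewrite derive_pt_acos, Rsqr_pow2. unfold Rdiv; ring.
Qed.

Lemma cos_diff_le (x m : R) : 0 <= m -> cos x - cos (x + m) <= m.
Proof.
intros Hm.
pose proof (nondecreasing_of_derive (fun t => cos (x + t) + t) (fun t => 1 - sin (x + t)) 0 m Hm) as H.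
cbv beta in H; rewrite !Rplus_0_r in H.
enough (cos x <= cos (x + m) + m) by lra.
apply H.
- intros t _; auto_derive; [trivial|ring].
- intros t _; pose proof (SIN_bound (x + t)); lra.
Qed.

(* Shrinking [f] to [cos m * f] keeps [acos] differentiable along the curve; the defect
   is removed by letting [m] tend to [0]. *)
Lemma acos_le_arc_length (f df l dl : R -> R) (a b : R) :
  a <= b -> (forall t, is_derive f t (df t)) -> (forall t, is_derive l t (dl t)) ->
  (forall t, a <= t <= b -> -1 <= f t <= 1) ->
  (forall t, a < t < b -> 0 <= dl t /\ df t ^ 2 <= dl t ^ 2 * (1 - f t ^ 2)) ->
  f a = 1 -> l a = 0 -> acos (f b) <= l b.
Proof.
intros Hab Hf Hl Hf1 Hd Hfa Hla.
assert (Hlb : 0 <= l b).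
{ rewrite <- Hla. apply (nondecreasing_of_derive l dl); [assumption| |].
  - intros; apply Hl.
  - intros t Ht; apply Hd, Ht. }
pose proof (acos_bound (f b)) as Hac.
destruct (Rle_lt_dec PI (l b)) as [H|HlPI]; [lra|].
assert (Hm : forall m, 0 < m < PI / 2 -> acos (cos m * f b) <= m + l b).
{ intros m Hm.
  assert (Hc : 0 < cos m < 1).
  { split; [apply cos_gt_0; lra|]. rewrite <- cos_0. apply cos_decreasing_1; lra. }
  set (k := cos m) in *.
  assert (Hk : forall t, a <= t <= b -> -1 < k * f t < 1) by (intros t Ht; specialize (Hf1 t Ht); nra).
  pose proof (nondecreasing_of_derive (fun t => l t - acos (k * f t))
    (fun t => dl t + / sqrt (1 - (k * f t) ^ 2) * (k * df t)) a b Hab) as H.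
  cbv beta in H. rewrite Hla, Hfa, Rmult_1_r in H.
  assert (Ek : acos k = m) by (apply acos_cos; lra). rewrite Ek in H.
  enough (0 - m <= l b - acos (k * f b)) by lra.
  apply H.
  - intros t Ht.
    replace (dl t + / sqrt (1 - (k * f t) ^ 2) * (k * df t))
      with (minus (dl t) (scal (k * df t) (- / sqrt (1 - (k * f t) ^ 2))))
      by (unfold minus, plus, opp, scal; simpl; unfold mult; simpl; ring).
    apply (is_derive_minus l (fun t => acos (k * f t))); [apply Hl|].
    apply (is_derive_comp acos (fun t => k * f t)); [apply is_derive_acos, Hk, Ht|].
    apply is_derive_scal, Hf.
  - intros t Ht. destruct (Hd t Ht) as [Hd0 Hd1].
    specialize (Hk t ltac:(lra)).
    assert (H0 : 0 < 1 - (k * f t) ^ 2) by nra.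
    set (S := sqrt (1 - (k * f t) ^ 2)).
    assert (HS : 0 < S) by now apply sqrt_lt_R0.
    assert (HS2 : S ^ 2 = 1 - (k * f t) ^ 2) by (unfold S; rewrite <- Rsqr_pow2; apply Rsqr_sqrt; lra).
    assert (Hb : (k * df t) ^ 2 <= (dl t * S) ^ 2).
    { rewrite !Rpow_mult_distr, HS2.
      apply Rle_trans with (k ^ 2 * (dl t ^ 2 * (1 - f t ^ 2))).
      - apply Rmult_le_compat_l; [apply pow2_ge_0|assumption].
      - replace (k ^ 2 * (dl t ^ 2 * (1 - f t ^ 2))) with (dl t ^ 2 * (k ^ 2 * (1 - f t ^ 2))) by ring.
        apply Rmult_le_compat_l; [apply pow2_ge_0|]. rewrite Rpow_mult_distr. nra. }
    assert (Hb2 : - (dl t * S) <= k * df t).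
    { assert (0 <= dl t * S) by (apply Rmult_le_pos; lra).
      pose proof (Rsqr_le_abs_0 (k * df t) (dl t * S)) as Hq. rewrite !Rsqr_pow2 in Hq.
      specialize (Hq Hb). rewrite (Rabs_right (dl t * S)) in Hq by lra.
      pose proof (Rle_abs (- (k * df t))) as Hq2. rewrite Rabs_Ropp in Hq2. lra. }
    replace (dl t) with (/ S * (dl t * S)) by (field; lra).
    rewrite <- Rmult_plus_distr_l. apply Rmult_le_pos; [apply Rlt_le, Rinv_0_lt_compat, HS|lra]. }
apply le_of_cos_le; [assumption|lra|].
specialize (Hf1 b ltac:(lra)). rewrite cos_acos by lra.
apply le_epsilon. intros eps Heps.
(* Besides staying below [PI / 2], [m] must keep [m + l b] below [PI], where the cosine decreases,
   and let two errors of size [m] fit into [eps]. *)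
set (m := Rmin (eps / 2) (Rmin (PI / 4) ((PI - l b) / 2))).
assert (H1 : 0 < m).
{ pose proof PI_RGT_0. repeat apply Rmin_glb_lt; lra. }
assert (H2 : m <= eps / 2) by apply Rmin_l.
assert (H3 : m <= PI / 4) by (eapply Rle_trans; [apply Rmin_r|apply Rmin_l]).
assert (H4 : m <= (PI - l b) / 2) by (eapply Rle_trans; [apply Rmin_r|apply Rmin_r]).
specialize (Hm m ltac:(lra)).
assert (Hcm : 0 <= 1 - cos m <= m).
{ split; [pose proof (COS_bound m); lra|].
  pose proof (cos_diff_le 0 m ltac:(lra)). rewrite cos_0, Rplus_0_l in H; lra. }
assert (H5 : cos (m + l b) <= cos m * f b).
{ rewrite <- (cos_acos (cos m * f b)).
  - pose proof (acos_bound (cos m * f b)). apply cos_decr_1; lra.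
  - pose proof (COS_bound m); nra. }
pose proof (cos_diff_le (l b) m ltac:(lra)) as H6. rewrite (Rplus_comm (l b)) in H6.
nra.
Qed.

Lemma is_derive_RInt_upper (f : R -> R) (a : R) :
  (forall t, continuous f t) ->
  (forall t, is_derive (fun x => RInt f a x) t (f t)).
Proof.
intros Hf t. apply (is_derive_RInt f _ a t); [|apply Hf].
apply filter_forall. intro x. apply (RInt_correct f).
apply ex_RInt_continuous. intros; apply Hf.
Qed.

Lemma le_of_forall_shift (x y A : R) :
  0 <= A -> (forall eps, 0 < eps -> x <= (A + eps) ^ 2 + y) -> x <= A ^ 2 + y.
Proof.
intros HA H. destruct (Rle_lt_dec x (A ^ 2 + y)) as [|Hlt]; [assumption|exfalso].
set (d := x - (A ^ 2 + y)).
set (e := Rmin 1 (d / (2 * (2 * A + 1)))).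
assert (Hd : 0 < d) by (unfold d; lra).
assert (He : 0 < e) by (apply Rmin_glb_lt; [lra|apply Rdiv_lt_0_compat; lra]).
assert (He1 : e <= 1) by apply Rmin_l.
assert (He2 : e <= d / (2 * (2 * A + 1))) by apply Rmin_r.
specialize (H e He).
assert (e * (2 * A + 1) <= d / 2).
{ replace (d / 2) with (d / (2 * (2 * A + 1)) * (2 * A + 1)) by (field; lra).
  apply Rmult_le_compat_r; lra. }
assert (e * e <= e) by nra.
unfold d in *. lra.
Qed.

Lemma acos_cos_sq_le (x : R) : acos (cos x) ^ 2 <= x ^ 2.
Proof.
pose proof (spherical_side_le 1 x 0 (acos (cos x)) ltac:(lra) (acos_bound _)) as H.
rewrite cos_0, sin_0 in H. rewrite cos_acos in H by apply COS_bound.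
enough (acos (cos x) ^ 2 <= x ^ 2 - 2 * x * 1 * 0 + 0 ^ 2) by lra.
apply H; ring.
Qed.

Lemma is_derive_sum_sq (f0 f1 f2 f3 : R -> R) (t d0 d1 d2 d3 : R) :
  is_derive f0 t d0 -> is_derive f1 t d1 -> is_derive f2 t d2 -> is_derive f3 t d3 ->
  is_derive (fun s => f0 s ^ 2 + f1 s ^ 2 + f2 s ^ 2 + f3 s ^ 2) t
    (2 * (f0 t * d0 + f1 t * d1 + f2 t * d2 + f3 t * d3)).
Proof.
intros D0 D1 D2 D3. auto_derive.
- repeat split; eexists; eassumption.
- change (fun x => f0 x) with f0; change (fun x => f1 x) with f1;
  change (fun x => f2 x) with f2; change (fun x => f3 x) with f3.
  rewrite (is_derive_unique f0 t _ D0), (is_derive_unique f1 t _ D1),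
    (is_derive_unique f2 t _ D2), (is_derive_unique f3 t _ D3). ring.
Qed.

(** The squared norm is constant near an interior point; the end points are excluded because the
    curve is only known to lie on the sphere over [[a, b]]. *)
Lemma on_S3_velocity (c dc : R -> quat) (a b t : R) :
  C1_curve c dc -> (forall t, a <= t <= b -> on_S3 (c t)) -> a < t < b ->
  q0 (qmul (qinv (c t)) (dc t)) = 0.
Proof.
intros Hc HS Ht.
destruct (Hc t) as [D0 [D1 [D2 [D3 _]]]].
set (N := fun s => q0 (c s) ^ 2 + q1 (c s) ^ 2 + q2 (c s) ^ 2 + q3 (c s) ^ 2).
assert (HN : is_derive N t (2 * (q0 (c t) * q0 (dc t) + q1 (c t) * q1 (dc t) +
   q2 (c t) * q2 (dc t) + q3 (c t) * q3 (dc t)))).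
{ now apply (is_derive_sum_sq (fun s => q0 (c s)) (fun s => q1 (c s))
    (fun s => q2 (c s)) (fun s => q3 (c s))). }
assert (HN0 : is_derive N t 0).
{ apply (is_derive_ext_loc (fun _ => 1)); [|apply (is_derive_const (V := R_NormedModule))].
  assert (Hd : 0 < Rmin (t - a) (b - t)) by (apply Rmin_glb_lt; lra).
  exists (mkposreal _ Hd). intros s Hs. symmetry; apply HS.
  assert (Hs' : Rabs (s - t) < Rmin (t - a) (b - t)) by exact Hs.
  pose proof (Rmin_l (t - a) (b - t)); pose proof (Rmin_r (t - a) (b - t)).
  apply Rabs_def2 in Hs'. lra. }
pose proof (is_derive_unique _ _ _ HN) as E1. pose proof (is_derive_unique _ _ _ HN0) as E2.
unfold qmul, qinv; simpl. lra.
Qed.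

Lemma berger_norm_components (I1 I3 : R) (x v : quat) :
  berger_norm I1 I3 x v =
  sqrt (4 * (I1 * (q1 (qmul (qinv x) v) ^ 2 + q2 (qmul (qinv x) v) ^ 2) +
             I3 * q3 (qmul (qinv x) v) ^ 2)).
Proof.
unfold berger_norm, au1, au2, au3. f_equal. ring.
Qed.

Lemma continuous_Rplus (f g : R -> R) (t : R) :
  continuous f t -> continuous g t -> continuous (fun s => f s + g s) t.
Proof. apply (continuous_plus (K := R_AbsRing) (V := R_NormedModule)). Qed.

Lemma continuous_Rminus (f g : R -> R) (t : R) :
  continuous f t -> continuous g t -> continuous (fun s => f s - g s) t.
Proof. apply (continuous_minus (K := R_AbsRing) (V := R_NormedModule)). Qed.

Lemma continuous_Ropp (f : R -> R) (t : R) :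
  continuous f t -> continuous (fun s => - f s) t.
Proof. apply (continuous_opp (K := R_AbsRing) (V := R_NormedModule)). Qed.

Lemma continuous_Rmult (f g : R -> R) (t : R) :
  continuous f t -> continuous g t -> continuous (fun s => f s * g s) t.
Proof. apply (continuous_mult (K := R_AbsRing)). Qed.

Ltac continuity_poly :=
  try assumption;
  lazymatch goal with
  | |- continuous (fun s => @?f s + @?g s) _ => apply (continuous_Rplus f g); continuity_poly
  | |- continuous (fun s => @?f s - @?g s) _ => apply (continuous_Rminus f g); continuity_poly
  | |- continuous (fun s => - @?f s) _ => apply (continuous_Ropp f); continuity_poly
  | |- continuous (fun s => @?f s * @?g s) _ => apply (continuous_Rmult f g); continuity_poly
  | |- _ => idtac
  end.

Lemma C1_curve_continuous (c dc : R -> quat) (t : R) :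
  C1_curve c dc ->
  continuous (fun s => q1 (qmul (qinv (c s)) (dc s))) t /\
  continuous (fun s => q2 (qmul (qinv (c s)) (dc s))) t /\
  continuous (fun s => q3 (qmul (qinv (c s)) (dc s))) t.
Proof.
intros Hc. destruct (Hc t) as [D0 [D1 [D2 [D3 [K0 [K1 [K2 K3]]]]]]].
assert (C0 : continuous (fun s => q0 (c s)) t)
  by (apply (ex_derive_continuous (K := R_AbsRing) (V := R_NormedModule)); eexists; eassumption).
assert (C1 : continuous (fun s => q1 (c s)) t)
  by (apply (ex_derive_continuous (K := R_AbsRing) (V := R_NormedModule)); eexists; eassumption).
assert (C2 : continuous (fun s => q2 (c s)) t)
  by (apply (ex_derive_continuous (K := R_AbsRing) (V := R_NormedModule)); eexists; eassumption).
assert (C3 : continuous (fun s => q3 (c s)) t)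
  by (apply (ex_derive_continuous (K := R_AbsRing) (V := R_NormedModule)); eexists; eassumption).
unfold qmul, qinv; simpl.
repeat split; continuity_poly.
Qed.

Lemma is_derive_twist (x y ch : R -> R) (t dx dy dch : R) :
  is_derive x t dx -> is_derive y t dy -> is_derive ch t dch ->
  is_derive (fun s => x s * cos (ch s) - y s * sin (ch s)) t
    (dx * cos (ch t) - dy * sin (ch t) - dch * (x t * sin (ch t) + y t * cos (ch t))).
Proof.
intros Dx Dy Dc. auto_derive.
- repeat split; eexists; eassumption.
- change (fun s => x s) with x; change (fun s => y s) with y; change (fun s => ch s) with ch.
  rewrite (is_derive_unique x t _ Dx), (is_derive_unique y t _ Dy), (is_derive_unique ch t _ Dc). ring.
Qed.

Lemma is_derive_lin3 (f g : R -> R) (t df dg u v w : R) :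
  is_derive f t df -> is_derive g t dg ->
  is_derive (fun s => u * f s + v * g s + w * s) t (u * df + v * dg + w).
Proof.
intros Df Dg. auto_derive.
- repeat split; eexists; eassumption.
- change (fun s => f s) with f; change (fun s => g s) with g.
  rewrite (is_derive_unique f t _ Df), (is_derive_unique g t _ Dg). ring.
Qed.

Lemma cauchy_schwarz3 (a1 a2 a3 b1 b2 b3 : R) :
  (a1 * b1 + a2 * b2 + a3 * b3) ^ 2 <= (a1 ^ 2 + a2 ^ 2 + a3 ^ 2) * (b1 ^ 2 + b2 ^ 2 + b3 ^ 2).
Proof.
pose proof (pow2_ge_0 (a1 * b2 - a2 * b1)); pose proof (pow2_ge_0 (a1 * b3 - a3 * b1));
pose proof (pow2_ge_0 (a2 * b3 - a3 * b2)). lra.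
Qed.

Lemma sqrt_sq (x : R) : 0 <= x -> sqrt x ^ 2 = x.
Proof. intros H; rewrite <- Rsqr_pow2; now apply Rsqr_sqrt. Qed.

Lemma le_sqrt_sq (x y : R) : x ^ 2 <= y -> x <= sqrt y.
Proof.
intros H. apply Rle_trans with (Rabs x); [apply Rle_abs|].
rewrite <- sqrt_Rsqr_abs, Rsqr_pow2. now apply sqrt_le_1_alt.
Qed.

(* The twisted speed: after rotating by [ch], the horizontal motion and the residual
   vertical motion [dps] bound the variation of the real part of [z exp(i ch)]. *)
Lemma twist_speed (x v : quat) (cc sc dps : R) :
  on_S3 x -> q0 (qmul (qinv x) v) = 0 -> sc ^ 2 + cc ^ 2 = 1 ->
  let X := qmul (qinv x) v in
  (q0 v * cc - q3 v * sc - (dps - q3 X) * (q0 x * sc + q3 x * cc)) ^ 2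
    <= (q1 X ^ 2 + q2 X ^ 2 + dps ^ 2) * (1 - (q0 x * cc - q3 x * sc) ^ 2).
Proof.
intros HS H0 Hcs X.
unfold on_S3 in HS.
set (N := q0 x ^ 2 + q1 x ^ 2 + q2 x ^ 2 + q3 x ^ 2) in HS.
assert (V0 : q0 v = - q1 x * q1 X - q2 x * q2 X - q3 x * q3 X).
{ assert (E : N * q0 v = q0 x * q0 X - q1 x * q1 X - q2 x * q2 X - q3 x * q3 X)
    by (unfold X, N, qmul, qinv; simpl; ring).
  fold X in H0. rewrite HS, H0 in E. lra. }
assert (V3 : q3 v = q0 x * q3 X + q1 x * q2 X - q2 x * q1 X).
{ assert (E : N * q3 v = q0 x * q3 X + q3 x * q0 X + q1 x * q2 X - q2 x * q1 X)
    by (unfold X, N, qmul, qinv; simpl; ring).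
  fold X in H0. rewrite HS, H0 in E. lra. }
pose proof (cauchy_schwarz3 (q1 X) (q2 X) dps (q1 x * cc - q2 x * sc) (q2 x * cc + q1 x * sc)
  (q0 x * sc + q3 x * cc)) as H.
replace (q0 v * cc - q3 v * sc - (dps - q3 X) * (q0 x * sc + q3 x * cc))
  with (- (q1 X * (q1 x * cc - q2 x * sc) + q2 X * (q2 x * cc + q1 x * sc) +
       dps * (q0 x * sc + q3 x * cc))) by (rewrite V0, V3; ring).
replace (1 - (q0 x * cc - q3 x * sc) ^ 2)
  with ((q1 x * cc - q2 x * sc) ^ 2 + (q2 x * cc + q1 x * sc) ^ 2 + (q0 x * sc + q3 x * cc) ^ 2).
- replace ((- (q1 X * (q1 x * cc - q2 x * sc) + q2 X * (q2 x * cc + q1 x * sc) +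
       dps * (q0 x * sc + q3 x * cc))) ^ 2) with ((q1 X * (q1 x * cc - q2 x * sc) + q2 X * (q2 x * cc + q1 x * sc) +
       dps * (q0 x * sc + q3 x * cc)) ^ 2) by ring. exact H.
- rewrite <- HS. unfold N.
  replace (q0 x ^ 2 + q1 x ^ 2 + q2 x ^ 2 + q3 x ^ 2) with
    ((q0 x ^ 2 + q1 x ^ 2 + q2 x ^ 2 + q3 x ^ 2) * (sc ^ 2 + cc ^ 2)) by (rewrite Hcs; ring).
  ring.
Qed.

Lemma curve_lower_bound (I1 I3 : R) (c dc : R -> quat) (a b chi : R) :
  0 < I1 -> 0 < I3 -> admissible_curve c dc a b ->
  q0 (c a) = cos chi -> q3 (c a) = - sin chi ->
  exists A B : R,
    2 * sqrt (I1 * A ^ 2 + I3 * B ^ 2) <= curve_length I1 I3 c dc a b /\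
    forall psi, acos (q0 (c b) * cos (chi + psi - B) - q3 (c b) * sin (chi + psi - B)) ^ 2
      <= A ^ 2 + psi ^ 2.
Proof.
intros HI1 HI3 [Hab [Hc HS]] Ha0 Ha3.
set (X := fun t => qmul (qinv (c t)) (dc t)).
set (va := fun t => sqrt (q1 (X t) ^ 2 + q2 (X t) ^ 2)).
assert (Hva2 : forall t, va t ^ 2 = q1 (X t) ^ 2 + q2 (X t) ^ 2).
{ intro t; apply sqrt_sq. pose proof (pow2_ge_0 (q1 (X t))); pose proof (pow2_ge_0 (q2 (X t))); lra. }
assert (Hva0 : forall t, 0 <= va t) by (intro; apply sqrt_pos).
assert (Cva : forall t, continuous va t).
{ intro t. destruct (C1_curve_continuous c dc t Hc) as [K1 [K2 K3]].
  apply continuous_sqrt_comp.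
  apply (continuous_ext (fun t => q1 (X t) * q1 (X t) + q2 (X t) * q2 (X t))); [intro; simpl; ring|].
  unfold X; continuity_poly. }
assert (CX3 : forall t, continuous (fun t => q3 (X t)) t).
{ intro t. apply (C1_curve_continuous c dc t Hc). }
assert (CN : forall t, continuous (fun t => berger_norm I1 I3 (c t) (dc t)) t).
{ intro t. destruct (C1_curve_continuous c dc t Hc) as [K1 [K2 K3]].
  apply (continuous_ext (fun t => sqrt (4 * (I1 * (q1 (X t) * q1 (X t) + q2 (X t) * q2 (X t)) +
     I3 * (q3 (X t) * q3 (X t)))))).
  { intro s; rewrite berger_norm_components. f_equal; unfold X; ring. }
  apply continuous_sqrt_comp. unfold X; continuity_poly; apply continuous_const. }
set (Af := fun t => RInt va a t). set (Bf := fun t => RInt (fun t => q3 (X t)) a t).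
set (Lf := fun t => RInt (fun t => berger_norm I1 I3 (c t) (dc t)) a t).
assert (DA : forall t, is_derive Af t (va t)) by (apply is_derive_RInt_upper, Cva).
assert (DB : forall t, is_derive Bf t (q3 (X t))) by (apply (is_derive_RInt_upper (fun t => q3 (X t))), CX3).
assert (DL : forall t, is_derive Lf t (berger_norm I1 I3 (c t) (dc t)))
  by (apply (is_derive_RInt_upper (fun t => berger_norm I1 I3 (c t) (dc t))), CN).
assert (A0 : Af a = 0) by apply (RInt_point (V := R_CompleteNormedModule)).
assert (B0 : Bf a = 0) by apply (RInt_point (V := R_CompleteNormedModule)).
assert (L0 : Lf a = 0) by apply (RInt_point (V := R_CompleteNormedModule)).
exists (Af b), (Bf b). change (curve_length I1 I3 c dc a b) with (Lf b).
set (A := Af b). set (B := Bf b).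
assert (HA : 0 <= A).
{ unfold A; rewrite <- A0. apply (nondecreasing_of_derive Af va); auto. }
assert (Hsq : forall x y, 0 <= I1 * x ^ 2 + I3 * y ^ 2).
{ intros x y. pose proof (pow2_ge_0 x); pose proof (pow2_ge_0 y).
  apply Rplus_le_le_0_compat; apply Rmult_le_pos; lra. }
split.
- assert (HL : 0 <= Lf b).
  { rewrite <- L0. apply (nondecreasing_of_derive Lf (fun t => berger_norm I1 I3 (c t) (dc t))); auto.
    intros; apply sqrt_pos. }
  set (S := sqrt (I1 * A ^ 2 + I3 * B ^ 2)).
  assert (HS2 : S ^ 2 = I1 * A ^ 2 + I3 * B ^ 2) by (apply sqrt_sq, Hsq).
  assert (HS0 : 0 <= S) by apply sqrt_pos.
  destruct HS0 as [HS0|HS0]; [|lra].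
  (* Minkowski's inequality for the integral of the speed: Cauchy-Schwarz at each time against the
     constant vector [(A, B)], then integration. *)
  assert (HG : 2 * S ^ 2 <= Lf b * S).
  { pose proof (nondecreasing_of_derive
      (fun t => S * Lf t + (-1) * (2 * I1 * A * Af t + 2 * I3 * B * Bf t + 0 * t) + 0 * t)
      (fun t => S * berger_norm I1 I3 (c t) (dc t) + (-1) * (2 * I1 * A * va t + 2 * I3 * B * q3 (X t) + 0) + 0)
      a b Hab) as H.
    cbv beta in H. rewrite A0, B0, L0 in H. fold A B in H.
    rewrite HS2. enough (S * 0 + -1 * (2 * I1 * A * 0 + 2 * I3 * B * 0 + 0 * a) + 0 * a <=
      S * Lf b + -1 * (2 * I1 * A * A + 2 * I3 * B * B + 0 * b) + 0 * b) by lra.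
    apply H.
    - intros t _. apply (is_derive_lin3 Lf (fun t => 2 * I1 * A * Af t + 2 * I3 * B * Bf t + 0 * t)); [apply DL|].
      apply is_derive_lin3; [apply DA|apply DB].
    - intros t _. rewrite berger_norm_components. fold (X t). rewrite <- Hva2.
      unfold S. rewrite <- sqrt_mult; [|apply Hsq|pose proof (Hsq (va t) (q3 (X t))); lra].
      enough (2 * I1 * A * va t + 2 * I3 * B * q3 (X t) <=
        sqrt ((I1 * A ^ 2 + I3 * B ^ 2) * (4 * (I1 * va t ^ 2 + I3 * q3 (X t) ^ 2)))) by lra.
      apply le_sqrt_sq.
      assert (0 <= I1 * I3 * (A * q3 (X t) - B * va t) ^ 2).
      { apply Rmult_le_pos; [apply Rmult_le_pos; lra|apply pow2_ge_0]. }
      lra. }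
  nra.
- intro psi. destruct (Req_dec a b) as [Eab|Nab].
  { unfold A, B. rewrite <- Eab, A0, B0, Ha0, Ha3.
    replace (cos chi * cos (chi + psi - 0) - - sin chi * sin (chi + psi - 0))
      with (cos (chi + psi - 0) * cos chi + sin (chi + psi - 0) * sin chi) by ring.
    rewrite <- cos_minus. replace (chi + psi - 0 - chi) with psi by ring.
    pose proof (acos_cos_sq_le psi). lra. }
  (* The horizontal length may vanish, so a uniform speed [k] of total [eps] is added before
     dividing by it. *)
  apply le_of_forall_shift; [assumption|]. intros eps Heps.
  set (Ae := A + eps). set (k := eps / (b - a)).
  assert (Hk : 0 < k) by (apply Rdiv_lt_0_compat; lra).
  assert (HAe : 0 < Ae) by (unfold Ae; lra).
  set (At := fun t => Af t + k * (t - a)).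
  set (S := sqrt (Ae ^ 2 + psi ^ 2)).
  assert (HS2 : S ^ 2 = Ae ^ 2 + psi ^ 2).
  { apply sqrt_sq. pose proof (pow2_ge_0 Ae); pose proof (pow2_ge_0 psi); lra. }
  assert (HS0 : 0 <= S) by apply sqrt_pos.
  (* This phase cancels the curve's own motion along the fibres and spreads [psi] proportionally to
     the horizontal length. The twisted speed is then at most the fixed multiple [S / Ae] of the
     modified horizontal speed. *)
  set (ch := fun t => chi + psi / Ae * At t - Bf t).
  assert (Dch : forall t, is_derive ch t (psi / Ae * (va t + k) - q3 (X t))).
  { intro t. apply (is_derive_ext (fun t => psi / Ae * Af t + (-1) * Bf t + psi / Ae * k * t +
      (chi - psi / Ae * k * a))).
    { intro s; unfold ch, At; lazymatch goal with |- @eq _ ?u ?v => change (@eq R u v) end; ring. }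
    replace (psi / Ae * (va t + k) - q3 (X t)) with
      (plus (psi / Ae * va t + (-1) * q3 (X t) + psi / Ae * k) 0) by (unfold plus; simpl; ring).
    apply (is_derive_plus (V := R_NormedModule)); [|apply (is_derive_const (V := R_NormedModule))].
    apply is_derive_lin3; auto. }
  assert (HAtb : At b = Ae) by (unfold At, Ae, k; fold A; field; lra).
  assert (Hchb : ch b = chi + psi - B) by (unfold ch; rewrite HAtb; fold B; field; lra).
  assert (HAta : At a = 0) by (unfold At; rewrite A0; ring).
  assert (Hcha : ch a = chi) by (unfold ch; rewrite HAta, B0; ring).
  assert (Hmain : acos (q0 (c b) * cos (ch b) - q3 (c b) * sin (ch b)) <= S / Ae * At b).
  { apply (acos_le_arc_length
      (fun t => q0 (c t) * cos (ch t) - q3 (c t) * sin (ch t))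
      (fun t => q0 (dc t) * cos (ch t) - q3 (dc t) * sin (ch t)
        - (psi / Ae * (va t + k) - q3 (X t)) * (q0 (c t) * sin (ch t) + q3 (c t) * cos (ch t)))
      (fun t => S / Ae * At t) (fun t => S / Ae * (va t + k)) a b Hab).
    - intro t. destruct (Hc t) as [D0 [D1 [D2 [D3 _]]]].
      apply (is_derive_twist (fun s => q0 (c s)) (fun s => q3 (c s)) ch); auto.
    - intro t. apply is_derive_scal.
      apply (is_derive_ext (fun t => 1 * Af t + 0 * Af t + k * t + (- k * a))).
      { intro s; unfold At; lazymatch goal with |- @eq _ ?u ?v => change (@eq R u v) end; ring. }
      replace (va t + k) with (plus (1 * va t + 0 * va t + k) 0) by (unfold plus; simpl; ring).
      apply (is_derive_plus (V := R_NormedModule)); [|apply (is_derive_const (V := R_NormedModule))].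
      apply is_derive_lin3; auto.
    - intros t Ht. specialize (HS t Ht). unfold on_S3 in HS.
      pose proof (sin2_cos2 (ch t)) as E; rewrite !Rsqr_pow2 in E.
      assert (Hle : (q0 (c t) * cos (ch t) - q3 (c t) * sin (ch t)) ^ 2 <= 1).
      { pose proof (pow2_ge_0 (q0 (c t) * sin (ch t) + q3 (c t) * cos (ch t))).
        assert (E2 : (q0 (c t) * cos (ch t) - q3 (c t) * sin (ch t)) ^ 2 +
          (q0 (c t) * sin (ch t) + q3 (c t) * cos (ch t)) ^ 2 =
          (q0 (c t) ^ 2 + q3 (c t) ^ 2) * (sin (ch t) ^ 2 + cos (ch t) ^ 2)) by ring.
        rewrite E in E2. pose proof (pow2_ge_0 (q1 (c t))); pose proof (pow2_ge_0 (q2 (c t))). lra. }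
      split; nra.
    - intros t Ht.
      assert (Hvk : 0 <= va t + k) by (specialize (Hva0 t); lra).
      assert (HSA : 0 <= S / Ae) by (apply Rmult_le_pos; [assumption|apply Rlt_le, Rinv_0_lt_compat, HAe]).
      split; [now apply Rmult_le_pos|].
      pose proof (sin2_cos2 (ch t)) as E; rewrite !Rsqr_pow2 in E.
      pose proof (twist_speed (c t) (dc t) (cos (ch t)) (sin (ch t)) (psi / Ae * (va t + k))
        (HS t ltac:(lra)) (on_S3_velocity c dc a b t Hc HS Ht) E) as H.
      cbv zeta in H. fold (X t) in H. eapply Rle_trans; [exact H|].
      apply Rmult_le_compat_r.
      + specialize (HS t ltac:(lra)). unfold on_S3 in HS.
        pose proof (pow2_ge_0 (q0 (c t) * sin (ch t) + q3 (c t) * cos (ch t))).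
        assert (E2 : (q0 (c t) * cos (ch t) - q3 (c t) * sin (ch t)) ^ 2 +
          (q0 (c t) * sin (ch t) + q3 (c t) * cos (ch t)) ^ 2 =
          (q0 (c t) ^ 2 + q3 (c t) ^ 2) * (sin (ch t) ^ 2 + cos (ch t) ^ 2)) by ring.
        rewrite E in E2. pose proof (pow2_ge_0 (q1 (c t))); pose proof (pow2_ge_0 (q2 (c t))). lra.
      + rewrite <- Hva2.
        replace ((S / Ae * (va t + k)) ^ 2) with (S ^ 2 / Ae ^ 2 * (va t + k) ^ 2) by (field; lra).
        rewrite HS2.
        replace ((Ae ^ 2 + psi ^ 2) / Ae ^ 2 * (va t + k) ^ 2)
          with ((va t + k) ^ 2 + (psi / Ae * (va t + k)) ^ 2) by (field; lra).
        apply Rplus_le_compat_r, sq_le. specialize (Hva0 t); lra.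
    - rewrite Hcha, Ha0, Ha3. pose proof (sin2_cos2 chi) as E; unfold Rsqr in E. lra.
    - rewrite HAta; ring. }
  rewrite HAtb, Hchb in Hmain.
  replace (S / Ae * Ae) with S in Hmain by (field; lra).
  fold Ae. rewrite <- HS2. apply sq_le. split; [apply acos_bound|assumption].
Qed.

(** * Twisted geodesics and the Hamiltonian flow *)

(* [exp(2 t om (w1 e1 + w2 e2 + u e3)) exp(2 t ep e3)] *)
Definition twisted (om u w1 w2 ep t : R) : quat :=
  mkQ (zre u (om * t) (ep * t))
      (sin (om * t) * (w1 * cos (ep * t) + w2 * sin (ep * t)))
      (sin (om * t) * (w2 * cos (ep * t) - w1 * sin (ep * t)))
      (zim u (om * t) (ep * t)).

(** The left-trivialized velocity of [twisted], halved by the convention of [alg]: the fibre factor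
    rotates the horizontal part by the angle [2 * ep * t] and adds [ep] to the vertical part. *)
Definition twisted_rate (om u w1 w2 ep t : R) : quat :=
  mkQ 0 (om * (w1 * cos (2 * (ep * t)) + w2 * sin (2 * (ep * t))))
        (om * (w2 * cos (2 * (ep * t)) - w1 * sin (2 * (ep * t))))
        (om * u + ep).

Lemma quat_eq (x y : quat) :
  q0 x = q0 y -> q1 x = q1 y -> q2 x = q2 y -> q3 x = q3 y -> x = y.
Proof. destruct x, y; simpl; intros; subst; reflexivity. Qed.

Lemma twisted_on_S3 (om u w1 w2 ep t : R) :
  w1 ^ 2 + w2 ^ 2 = 1 - u ^ 2 -> on_S3 (twisted om u w1 w2 ep t).
Proof.
intros Hw. unfold on_S3, twisted, zre, zim; simpl q0; simpl q1; simpl q2; simpl q3.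
pose proof (sin2_cos2 (om * t)) as E1; pose proof (sin2_cos2 (ep * t)) as E2.
rewrite !Rsqr_pow2 in E1, E2.
set (ca := cos (om * t)) in *; set (sa := sin (om * t)) in *.
set (cb := cos (ep * t)) in *; set (sb := sin (ep * t)) in *.
transitivity ((sb ^ 2 + cb ^ 2) * (ca ^ 2 + u ^ 2 * sa ^ 2 + (w1 ^ 2 + w2 ^ 2) * sa ^ 2)); [ring|].
rewrite E2, Hw. transitivity (sa ^ 2 + ca ^ 2); [ring|assumption].
Qed.

Lemma twisted_derive (om u w1 w2 ep t : R) :
  w1 ^ 2 + w2 ^ 2 = 1 - u ^ 2 ->
  let v := qmul (twisted om u w1 w2 ep t) (twisted_rate om u w1 w2 ep t) in
  is_derive (fun s => q0 (twisted om u w1 w2 ep s)) t (q0 v) /\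
  is_derive (fun s => q1 (twisted om u w1 w2 ep s)) t (q1 v) /\
  is_derive (fun s => q2 (twisted om u w1 w2 ep s)) t (q2 v) /\
  is_derive (fun s => q3 (twisted om u w1 w2 ep s)) t (q3 v).
Proof.
intros Hw.
cbv [qmul twisted twisted_rate zre zim q0 q1 q2 q3].
rewrite cos_2a, sin_2a.
pose proof (sin2_cos2 (ep * t)) as E2.
rewrite !Rsqr_pow2 in E2.
assert (E3 : cos (ep * t) ^ 2 = 1 - sin (ep * t) ^ 2) by lra.
assert (Hw1 : w1 ^ 2 = 1 - u ^ 2 - w2 ^ 2) by lra.
split; [|split; [|split]]; (auto_derive; [trivial|]);
set (ca := cos (om * t)) in *; set (sa := sin (om * t)) in *;
set (cb := cos (ep * t)) in *; set (sb := sin (ep * t)) in *;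
clearbody ca sa cb sb; ring [E3 Hw1].
Qed.

Lemma is_derive_continuous_R (f : R -> R) (t d : R) : is_derive f t d -> continuous f t.
Proof.
intros H. apply (ex_derive_continuous (K := R_AbsRing) (V := R_NormedModule)).
now exists d.
Qed.

Lemma twisted_C1 (om u w1 w2 ep : R) :
  w1 ^ 2 + w2 ^ 2 = 1 - u ^ 2 ->
  C1_curve (twisted om u w1 w2 ep)
    (fun t => qmul (twisted om u w1 w2 ep t) (twisted_rate om u w1 w2 ep t)).
Proof.
intros Hw t.
destruct (twisted_derive om u w1 w2 ep t Hw) as [D0 [D1 [D2 D3]]].
do 4 (split; [assumption|]).
apply is_derive_continuous_R in D0; apply is_derive_continuous_R in D1;
apply is_derive_continuous_R in D2; apply is_derive_continuous_R in D3.
assert (R1 : continuous (fun s => q1 (twisted_rate om u w1 w2 ep s)) t).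
{ simpl. apply (ex_derive_continuous (K := R_AbsRing) (V := R_NormedModule)). auto_derive; trivial. }
assert (R2 : continuous (fun s => q2 (twisted_rate om u w1 w2 ep s)) t).
{ simpl. apply (ex_derive_continuous (K := R_AbsRing) (V := R_NormedModule)). auto_derive; trivial. }
assert (R3 : continuous (fun s => q3 (twisted_rate om u w1 w2 ep s)) t)
  by apply continuous_const.
assert (R0 : continuous (fun s => q0 (twisted_rate om u w1 w2 ep s)) t)
  by apply continuous_const.
unfold qmul. cbv [q0 q1 q2 q3] in D0, D1, D2, D3, R0, R1, R2, R3 |- *.
repeat split; continuity_poly.
Qed.

Lemma berger_norm_left (I1 I3 u1 u2 u3 : R) (x : quat) :
  on_S3 x ->
  berger_norm I1 I3 x (qmul x (mkQ 0 u1 u2 u3)) = sqrt (4 * (I1 * (u1 ^ 2 + u2 ^ 2) + I3 * u3 ^ 2)).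
Proof.
intros HS. unfold on_S3 in HS. rewrite berger_norm_components. f_equal.
set (N := q0 x ^ 2 + q1 x ^ 2 + q2 x ^ 2 + q3 x ^ 2) in HS.
assert (E1 : q1 (qmul (qinv x) (qmul x (mkQ 0 u1 u2 u3))) = N * u1)
  by (unfold N, qmul, qinv; simpl; ring).
assert (E2 : q2 (qmul (qinv x) (qmul x (mkQ 0 u1 u2 u3))) = N * u2)
  by (unfold N, qmul, qinv; simpl; ring).
assert (E3 : q3 (qmul (qinv x) (qmul x (mkQ 0 u1 u2 u3))) = N * u3)
  by (unfold N, qmul, qinv; simpl; ring).
rewrite E1, E2, E3, HS. ring.
Qed.

Lemma RInt_constant (f : R -> R) (k b : R) :
  0 <= b -> (forall t, f t = k) -> RInt f 0 b = b * k.
Proof.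
intros Hb Hf. rewrite (RInt_ext f (fun _ => k)).
- rewrite RInt_const. unfold scal; simpl; unfold mult; simpl. ring.
- intros; apply Hf.
Qed.

Lemma twisted_length (I1 I3 om u w1 w2 ep : R) :
  w1 ^ 2 + w2 ^ 2 = 1 - u ^ 2 ->
  curve_length I1 I3 (twisted om u w1 w2 ep)
    (fun t => qmul (twisted om u w1 w2 ep t) (twisted_rate om u w1 w2 ep t)) 0 1 =
  sqrt (4 * (I1 * (om ^ 2 * (1 - u ^ 2)) + I3 * (om * u + ep) ^ 2)).
Proof.
intros Hw. unfold curve_length.
rewrite (RInt_constant _ (sqrt (4 * (I1 * (om ^ 2 * (1 - u ^ 2)) + I3 * (om * u + ep) ^ 2)))); [ring|lra|].
intro t. unfold twisted_rate. rewrite berger_norm_left by now apply twisted_on_S3.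
do 4 f_equal.
pose proof (sin2_cos2 (2 * (ep * t))) as E; rewrite !Rsqr_pow2 in E.
set (cc := cos (2 * (ep * t))) in *; set (sc := sin (2 * (ep * t))) in *.
transitivity (om ^ 2 * ((w1 ^ 2 + w2 ^ 2) * (sc ^ 2 + cc ^ 2))); [ring|].
rewrite E, Hw; ring.
Qed.

Lemma constant_of_derive_0 (f : R -> R) : (forall t, is_derive f t 0) -> forall t, f t = f 0.
Proof.
intros Hf t.
destruct (MVT_gen f 0 t (fun _ => 0)) as [c [_ Hc]]; [intros; apply Hf| |lra].
intros x _. apply derivable_continuous_pt. exists 0. apply is_derive_Reals, Hf.
Qed.

Lemma sum_sq_eq_0 (a b c d : R) :
  a ^ 2 + b ^ 2 + c ^ 2 + d ^ 2 = 0 -> a = 0 /\ b = 0 /\ c = 0 /\ d = 0.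
Proof.
intros H.
pose proof (pow2_ge_0 a); pose proof (pow2_ge_0 b); pose proof (pow2_ge_0 c); pose proof (pow2_ge_0 d).
repeat split; apply Rsqr_0_uniq; rewrite Rsqr_pow2; lra.
Qed.

Lemma is_derive_Rminus (f g : R -> R) (t df dg : R) :
  is_derive f t df -> is_derive g t dg -> is_derive (fun s => f s - g s) t (df - dg).
Proof. apply (is_derive_minus (K := R_AbsRing) (V := R_NormedModule)). Qed.

(* Right multiplication by an imaginary quaternion is skew-symmetric, so two solutions of
   the linear equation for [gam] stay at constant Euclidean distance. *)
Lemma trajectory_explicit (I1 I3 h1 h2 h3 nh : R) (gam : R -> quat) (M1 M2 M3 : R -> R) :
  0 < I1 -> 0 < I3 -> 0 < nh -> nh ^ 2 = h1 ^ 2 + h2 ^ 2 + h3 ^ 2 ->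
  hamiltonian_traj I1 I3 h1 h2 h3 gam M1 M2 M3 ->
  forall t,
    M3 t = h3 /\ M1 t ^ 2 + M2 t ^ 2 = h1 ^ 2 + h2 ^ 2 /\
    gam t = twisted (nh / (2 * I1)) (h3 / nh) (h1 / nh) (h2 / nh)
              (nh / (2 * I1) * (I1 / I3 - 1) * (h3 / nh)) t.
Proof.
intros HI1 HI3 Hnh Hnh2 [G0 [M10 [M20 [M30 H]]]].
set (om := nh / (2 * I1)). set (s := h3 / nh). set (w1 := h1 / nh). set (w2 := h2 / nh).
set (ep := om * (I1 / I3 - 1) * s).
assert (Eep : ep = h3 / (2 * I3) - h3 / (2 * I1)) by (unfold ep, om, s; field; lra).
assert (Hw : w1 ^ 2 + w2 ^ 2 = 1 - s ^ 2).
{ unfold w1, w2, s. replace ((h1 / nh) ^ 2 + (h2 / nh) ^ 2) with ((h1 ^ 2 + h2 ^ 2) / nh ^ 2) by (field; lra).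
  replace (h1 ^ 2 + h2 ^ 2) with (nh ^ 2 - h3 ^ 2) by lra. field; lra. }
assert (E3 : forall t, M3 t = h3).
{ intro t. rewrite <- M30. apply constant_of_derive_0. intro r.
  destruct (H r) as [_ [_ [H3 _]]].
  replace 0 with (M1 r * (M2 r / I1) - M2 r * (M1 r / I1)) by (field; lra). exact H3. }
(* With [M3] constant, the other two components precess about [e3] at rate [2 * ep]; uniqueness
   follows from a constant squared distance here too. *)
set (m1 := fun t => h1 * cos (2 * (ep * t)) + h2 * sin (2 * (ep * t))).
set (m2 := fun t => h2 * cos (2 * (ep * t)) - h1 * sin (2 * (ep * t))).
assert (E12 : forall t, M1 t = m1 t /\ M2 t = m2 t).
{ intro t.
  assert (Z : (M1 t - m1 t) ^ 2 + (M2 t - m2 t) ^ 2 + 0 ^ 2 + 0 ^ 2 = 0).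
  { transitivity ((M1 0 - m1 0) ^ 2 + (M2 0 - m2 0) ^ 2 + 0 ^ 2 + 0 ^ 2).
    - apply (constant_of_derive_0 (fun t => (M1 t - m1 t) ^ 2 + (M2 t - m2 t) ^ 2 + 0 ^ 2 + 0 ^ 2)).
      intro r. destruct (H r) as [H1 [H2 _]]. rewrite E3 in H1, H2.
      assert (D1 : is_derive m1 r (2 * ep * m2 r)) by (unfold m1, m2; auto_derive; [trivial|ring]).
      assert (D2 : is_derive m2 r (- (2 * ep * m1 r))) by (unfold m1, m2; auto_derive; [trivial|ring]).
      pose proof (is_derive_sum_sq _ _ (fun _ => 0) (fun _ => 0) r _ _ 0 0
        (is_derive_Rminus _ _ _ _ _ H1 D1) (is_derive_Rminus _ _ _ _ _ H2 D2)
        (is_derive_const (V := R_NormedModule) 0 r) (is_derive_const (V := R_NormedModule) 0 r)) as D.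
      cbv beta in D.
      match type of D with is_derive _ _ ?d => assert (Ed : d = 0) by (rewrite Eep; field; lra) end.
      rewrite Ed in D; exact D.
    - unfold m1, m2. rewrite M10, M20, !Rmult_0_r, cos_0, sin_0. ring. }
  destruct (sum_sq_eq_0 _ _ _ _ Z) as [Z1 [Z2 _]]. lra. }
intro t. split; [apply E3|]. split.
{ destruct (E12 t) as [-> ->]. unfold m1, m2.
  pose proof (sin2_cos2 (2 * (ep * t))) as E; rewrite !Rsqr_pow2 in E.
  set (cc := cos (2 * (ep * t))) in *; set (sc := sin (2 * (ep * t))) in *.
  transitivity ((h1 ^ 2 + h2 ^ 2) * (sc ^ 2 + cc ^ 2)); [ring|]. rewrite E; ring. }
set (X := twisted om s w1 w2 ep).
assert (Hrate : forall r, alg (M1 r / I1) (M2 r / I1) (M3 r / I3) = twisted_rate om s w1 w2 ep r).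
{ intro r. destruct (E12 r) as [F1 F2]. unfold alg, twisted_rate. rewrite F1, F2, E3. unfold m1, m2.
  f_equal; [| |rewrite Eep]; unfold om, w1, w2, s; field; lra. }
assert (Z : (q0 (gam t) - q0 (X t)) ^ 2 + (q1 (gam t) - q1 (X t)) ^ 2 +
  (q2 (gam t) - q2 (X t)) ^ 2 + (q3 (gam t) - q3 (X t)) ^ 2 = 0).
{ transitivity ((q0 (gam 0) - q0 (X 0)) ^ 2 + (q1 (gam 0) - q1 (X 0)) ^ 2 +
    (q2 (gam 0) - q2 (X 0)) ^ 2 + (q3 (gam 0) - q3 (X 0)) ^ 2).
  - apply (constant_of_derive_0 (fun t => (q0 (gam t) - q0 (X t)) ^ 2 + (q1 (gam t) - q1 (X t)) ^ 2 +
      (q2 (gam t) - q2 (X t)) ^ 2 + (q3 (gam t) - q3 (X t)) ^ 2)).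
    intro r. destruct (H r) as [_ [_ [_ [G1 [G2 [G3 G4]]]]]].
    destruct (twisted_derive om s w1 w2 ep r Hw) as [T1 [T2 [T3 T4]]].
    rewrite Hrate in G1, G2, G3, G4. fold X in T1, T2, T3, T4.
    pose proof (is_derive_sum_sq _ _ _ _ r _ _ _ _
      (is_derive_Rminus _ _ _ _ _ G1 T1) (is_derive_Rminus _ _ _ _ _ G2 T2)
      (is_derive_Rminus _ _ _ _ _ G3 T3) (is_derive_Rminus _ _ _ _ _ G4 T4)) as D.
    cbv beta in D.
    match type of D with is_derive _ _ ?d =>
      assert (Ed : d = 0) by (unfold qmul, twisted_rate; simpl; ring) end.
    rewrite Ed in D; exact D.
  - rewrite G0. unfold X, twisted, zre, zim. rewrite !Rmult_0_r, cos_0, sin_0. simpl. ring. }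
destruct (sum_sq_eq_0 _ _ _ _ Z) as [Z1 [Z2 [Z3 Z4]]].
apply quat_eq; lra.
Qed.

(** * Cut time *)

Lemma zre_add (s tau x y : R) : zre s tau x * cos y - zim s tau x * sin y = zre s tau (x + y).
Proof. unfold zre, zim; rewrite cos_plus, sin_plus; ring. Qed.

Lemma zim_add (s tau x y : R) : zre s tau x * sin y + zim s tau x * cos y = zim s tau (x + y).
Proof. unfold zre, zim; rewrite cos_plus, sin_plus; ring. Qed.

Lemma trajectory_length (I1 I3 h1 h2 h3 nh : R) (gam : R -> quat) (M1 M2 M3 : R -> R) (t : R) :
  0 < I1 -> 0 < I3 -> 0 < nh -> nh ^ 2 = h1 ^ 2 + h2 ^ 2 + h3 ^ 2 ->
  (h1 ^ 2 + h2 ^ 2) / I1 + h3 ^ 2 / I3 = 1 ->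
  hamiltonian_traj I1 I3 h1 h2 h3 gam M1 M2 M3 -> 0 <= t ->
  curve_length I1 I3 gam (traj_velocity I1 I3 gam M1 M2 M3) 0 t = t.
Proof.
intros HI1 HI3 Hnh Hnh2 HC Htr Ht. unfold curve_length.
rewrite (RInt_constant _ 1); [ring|assumption|].
intro r. destruct (trajectory_explicit I1 I3 h1 h2 h3 nh gam M1 M2 M3 HI1 HI3 Hnh Hnh2 Htr r)
  as [E3 [E12 EG]].
unfold traj_velocity, alg. rewrite berger_norm_left.
- rewrite <- sqrt_1. f_equal. rewrite E3, <- HC, <- E12. field; lra.
- rewrite EG. apply twisted_on_S3.
  replace ((h1 / nh) ^ 2 + (h2 / nh) ^ 2) with ((h1 ^ 2 + h2 ^ 2) / nh ^ 2) by (field; lra).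
  replace (h1 ^ 2 + h2 ^ 2) with (nh ^ 2 - h3 ^ 2) by lra. field; lra.
Qed.

(** Once the first coordinate agrees, the sphere fixes the modulus of the second, and the horizontal
    direction [(w1, w2)] can be turned to give its phase. If [sin sg = 0] the second coordinate
    vanishes and any direction serves. *)
Lemma twisted_reaches (sg u ep : R) (y : quat) :
  on_S3 y -> q0 y = zre u sg ep -> q3 y = zim u sg ep -> -1 <= u <= 1 ->
  exists w1 w2, w1 ^ 2 + w2 ^ 2 = 1 - u ^ 2 /\ twisted sg u w1 w2 ep 1 = y.
Proof.
intros HS E0 E3 Hu. unfold on_S3 in HS.
pose proof (sin2_cos2 sg) as F; pose proof (sin2_cos2 ep) as G; rewrite !Rsqr_pow2 in F, G.
assert (Hm : q1 y ^ 2 + q2 y ^ 2 = (1 - u ^ 2) * sin sg ^ 2).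
{ assert (E : zre u sg ep ^ 2 + zim u sg ep ^ 2 =
    (cos sg ^ 2 + u ^ 2 * sin sg ^ 2) * (sin ep ^ 2 + cos ep ^ 2)) by (unfold zre, zim; ring).
  rewrite G in E. rewrite E0, E3 in HS. lra. }
unfold twisted. rewrite !Rmult_1_r.
destruct (Req_dec (sin sg) 0) as [Hs|Hs].
- exists (sqrt (1 - u ^ 2)), 0. split; [rewrite sqrt_sq; nra|].
  rewrite Hs in *.
  destruct (sum_sq_eq_0 (q1 y) (q2 y) 0 0) as [Y1 [Y2 _]]; [lra|].
  apply quat_eq; simpl; lra.
- exists ((q1 y * cos ep - q2 y * sin ep) / sin sg), ((q2 y * cos ep + q1 y * sin ep) / sin sg).
  split.
  + transitivity ((q1 y ^ 2 + q2 y ^ 2) * (sin ep ^ 2 + cos ep ^ 2) / sin sg ^ 2); [field; assumption|].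
    rewrite Hm, G. field; assumption.
  + apply quat_eq; simpl; [now symmetry| | |now symmetry].
    * transitivity (q1 y * (sin ep ^ 2 + cos ep ^ 2)); [field; assumption|rewrite G; ring].
    * transitivity (q2 y * (sin ep ^ 2 + cos ep ^ 2)); [field; assumption|rewrite G; ring].
Qed.

Lemma lens_act_on_S3 (p q k : Z) (x : quat) : on_S3 x -> on_S3 (lens_act p q k x).
Proof.
unfold on_S3, lens_act; cbv zeta; simpl q0; simpl q1; simpl q2; simpl q3.
set (al := 2 * PI * IZR k / IZR p). set (be := 2 * PI * IZR k * IZR q / IZR p). intros H.
pose proof (sin2_cos2 al) as F; pose proof (sin2_cos2 be) as G; rewrite !Rsqr_pow2 in F, G.
transitivity ((q0 x ^ 2 + q3 x ^ 2) * (sin al ^ 2 + cos al ^ 2) +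
  (q1 x ^ 2 + q2 x ^ 2) * (sin be ^ 2 + cos be ^ 2)); [ring|].
rewrite F, G; lra.
Qed.

Lemma cut_time_of_parameter (p q : Z) (I1 I3 h1 h2 h3 nh T : R) (gam : R -> quat) (M1 M2 M3 : R -> R) :
  0 < I1 -> 0 < I3 -> 0 < nh -> nh ^ 2 = h1 ^ 2 + h2 ^ 2 + h3 ^ 2 ->
  (h1 ^ 2 + h2 ^ 2) / I1 + h3 ^ 2 / I3 = 1 ->
  hamiltonian_traj I1 I3 h1 h2 h3 gam M1 M2 M3 ->
  0 < T -> cut_parameter (I1 / I3 - 1) p (h3 / nh) T ->
  is_cut_time p q I1 I3 gam M1 M2 M3 (2 * I1 * T / nh).
Proof.
intros HI1 HI3 Hnh Hnh2 HC Htr HT [Hmin Himp].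
set (eta := I1 / I3 - 1) in *. set (s := h3 / nh) in *.
set (om := nh / (2 * I1)).
assert (Hom : 0 < om) by (apply Rdiv_lt_0_compat; lra).
assert (He : 1 + eta = I1 / I3) by (unfold eta; ring).
assert (Hep : 0 < 1 + eta) by (rewrite He; apply Rdiv_lt_0_compat; lra).
assert (EI : forall a b, I1 * a ^ 2 + I3 * b ^ 2 = I1 * (a ^ 2 + b ^ 2 / (1 + eta)))
  by (intros a b; rewrite He; field; lra).
(* The equation of [C] converts cost into time: with [tau = om * t], the cost [tau^2 (1 + eta s^2)]
   times [4 * I1] is [t^2]. *)
assert (Ecost : forall t, 4 * (I1 * ((om * t) ^ 2 * (1 + eta * s ^ 2))) = t ^ 2).
{ intro t. transitivity (t ^ 2 * ((h1 ^ 2 + h2 ^ 2) / I1 + h3 ^ 2 / I3)); [|rewrite HC; ring].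
  replace (h1 ^ 2 + h2 ^ 2) with (nh ^ 2 - h3 ^ 2) by lra.
  unfold om, eta, s. field; lra. }
assert (Hgam : forall t, q0 (gam t) = zre s (om * t) (om * t * eta * s) /\
   q3 (gam t) = zim s (om * t) (om * t * eta * s) /\ on_S3 (gam t)).
{ intro t. destruct (trajectory_explicit I1 I3 h1 h2 h3 nh gam M1 M2 M3 HI1 HI3 Hnh Hnh2 Htr t)
    as [_ [_ EG]].
  rewrite EG. unfold twisted at 1 2; simpl q0; simpl q3. fold om eta s.
  replace (om * eta * s * t) with (om * t * eta * s) by ring.
  split; [reflexivity|]. split; [reflexivity|]. apply twisted_on_S3. unfold s.
  replace ((h1 / nh) ^ 2 + (h2 / nh) ^ 2) with ((h1 ^ 2 + h2 ^ 2) / nh ^ 2) by (field; lra).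
  replace (h1 ^ 2 + h2 ^ 2) with (nh ^ 2 - h3 ^ 2) by lra. field; lra. }
assert (Hlen := fun t => trajectory_length I1 I3 h1 h2 h3 nh gam M1 M2 M3 t HI1 HI3 Hnh Hnh2 HC Htr).
assert (HTm : om * (2 * I1 * T / nh) = T) by (unfold om; field; lra).
assert (HT0 : 0 < 2 * I1 * T / nh).
{ apply Rdiv_lt_0_compat; [|assumption]. apply Rmult_lt_0_compat; lra. }
split.
- intros t [Ht Hmt]. destruct (Rle_lt_dec t (2 * I1 * T / nh)) as [|Hlt]; [assumption|exfalso].
  assert (HTt : T < om * t) by (rewrite <- HTm; apply Rmult_lt_compat_l; assumption).
  destruct (Himp _ HTt) as [sg [u [b [j [Hu [H1 [H2 H3]]]]]]].
  destruct (Hgam t) as [G0 [G3 GS]].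
  set (y := lens_act p q j (gam t)).
  assert (Y0 : q0 y = zre u sg (b - sg * u)).
  { rewrite H1, <- zre_add, <- G0, <- G3. unfold y, lens_act; simpl; ring. }
  assert (Y3 : q3 y = zim u sg (b - sg * u)).
  { rewrite H2, <- zim_add, <- G0, <- G3. unfold y, lens_act; simpl; ring. }
  destruct (twisted_reaches sg u (b - sg * u) y) as [w1 [w2 [Hw Hy]]]; try assumption.
  { apply lens_act_on_S3, GS. }
  specialize (Hmt (twisted sg u w1 w2 (b - sg * u))
    (fun r => qmul (twisted sg u w1 w2 (b - sg * u) r) (twisted_rate sg u w1 w2 (b - sg * u) r)) 0 1).
  rewrite Hlen, twisted_length in Hmt by (try assumption; lra).
  assert (Hle : t <= sqrt (4 * (I1 * (sg ^ 2 * (1 - u ^ 2)) + I3 * (sg * u + (b - sg * u)) ^ 2))).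
  { apply Hmt.
    - split; [lra|]. split; [now apply twisted_C1|]. intros; now apply twisted_on_S3.
    - exists 0%Z. unfold twisted, lens_act, zre, zim, qid; simpl.
      replace (2 * PI * 0 / IZR p) with 0 by (unfold Rdiv; ring).
      replace (2 * PI * 0 * IZR q / IZR p) with 0 by (unfold Rdiv; ring).
      rewrite !Rmult_0_r, cos_0, sin_0. f_equal; ring.
    - exists j. exact Hy. }
  replace (sg * u + (b - sg * u)) with b in Hle by ring.
  assert (H4 : 4 * (I1 * (sg ^ 2 * (1 - u ^ 2)) + I3 * b ^ 2) < t ^ 2).
  { rewrite <- (Ecost t). apply Rmult_lt_compat_l; [lra|].
    replace (I1 * (sg ^ 2 * (1 - u ^ 2)) + I3 * b ^ 2)
      with (I1 * (sg ^ 2 * (1 - u ^ 2) + b ^ 2 / (1 + eta))) by (rewrite He; field; lra).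
    apply Rmult_lt_compat_l; assumption. }
  assert (H5 : 0 <= 4 * (I1 * (sg ^ 2 * (1 - u ^ 2)) + I3 * b ^ 2)).
  { apply Rmult_le_pos; [lra|]. apply Rplus_le_le_0_compat.
    - apply Rmult_le_pos; [lra|]. apply Rmult_le_pos; [apply pow2_ge_0|nra].
    - apply Rmult_le_pos; [lra|apply pow2_ge_0]. }
  pose proof (sqrt_lt_1_alt _ _ (conj H5 H4)) as H6.
  rewrite <- (Rsqr_pow2 t), sqrt_Rsqr in H6 by lra. lra.
- intros B HB. destruct (Rle_lt_dec (2 * I1 * T / nh) B) as [|Hlt]; [assumption|exfalso].
  (* A test time between the supposed upper bound and the cut; the maximum with [0] keeps it
     positive. *)
  set (t := (Rmax B 0 + 2 * I1 * T / nh) / 2).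
  assert (HBm : Rmax B 0 < 2 * I1 * T / nh) by (apply Rmax_lub_lt; assumption).
  assert (HB0 : B <= Rmax B 0 /\ 0 <= Rmax B 0) by (split; [apply Rmax_l|apply Rmax_r]).
  assert (Ht : 0 < t < 2 * I1 * T / nh) by (unfold t; lra).
  enough (t <= B) by (unfold t in *; lra).
  apply HB. split; [lra|].
  intros c dc a b Hadm [k Hk] [k' Hk'].
  rewrite Hlen by lra.
  destruct (Hgam t) as [G0 [G3 _]].
  destruct (curve_lower_bound I1 I3 c dc a b (- (2 * PI * IZR k / IZR p)) HI1 HI3 Hadm) as [A [D [HL HP]]].
  { rewrite Hk, cos_neg. unfold lens_act, qid; simpl; ring. }
  { rewrite Hk, sin_neg. unfold lens_act, qid; simpl; ring. }
  apply Rle_trans with (2 := HL).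
  assert (Hot : 0 < om * t < T).
  { split; [apply Rmult_lt_0_compat; lra|]. rewrite <- HTm. apply Rmult_lt_compat_l; lra. }
  assert (Hcost : (om * t) ^ 2 * (1 + eta * s ^ 2) <= A ^ 2 + D ^ 2 / (1 + eta)).
  (* The phase [chi] turns the first coordinate of the starting point to [1], so only the relative
     translate [k' - k] remains. *)
  { apply (Hmin (om * t) Hot A D (k' - k)%Z). intro psi. specialize (HP psi).
    replace (om * t * eta * s + 2 * PI * IZR (k' - k) / IZR p + psi - D)
      with (om * t * eta * s + (2 * PI * IZR k' / IZR p + (- (2 * PI * IZR k / IZR p) + psi - D)))
      by (rewrite minus_IZR; unfold Rdiv; ring).
    rewrite <- zre_add, <- G0, <- G3.
    set (x := - (2 * PI * IZR k / IZR p) + psi - D) in *.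
    replace (q0 (c b) * cos x - q3 (c b) * sin x)
      with (q0 (gam t) * cos (2 * PI * IZR k' / IZR p + x) - q3 (gam t) * sin (2 * PI * IZR k' / IZR p + x))
      in HP; [exact HP|].
    rewrite Hk'. unfold lens_act; simpl. rewrite cos_plus, sin_plus; ring. }
  rewrite EI.
  assert (H5 : I1 * ((om * t) ^ 2 * (1 + eta * s ^ 2)) <= I1 * (A ^ 2 + D ^ 2 / (1 + eta)))
    by (apply Rmult_le_compat_l; lra).
  assert (H6 : t / 2 <= sqrt (I1 * (A ^ 2 + D ^ 2 / (1 + eta)))).
  { apply le_sqrt_sq. specialize (Ecost t). lra. }
  lra.
Qed.

Theorem mainTheorem8 :
  forall (p q : Z) (I1 I3 h1 h2 h3 : R) (gam : R -> quat) (M1 M2 M3 : R -> R),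
    (2 <= p)%Z -> Z.gcd p q = 1%Z -> 0 < I1 -> 0 < I3 ->
    (h1 ^ 2 + h2 ^ 2) / I1 + h3 ^ 2 / I3 = 1 ->
    hamiltonian_traj I1 I3 h1 h2 h3 gam M1 M2 M3 ->
    let eta := I1 / I3 - 1 in
    let nh := sqrt (h1 ^ 2 + h2 ^ 2 + h3 ^ 2) in
    let s := h3 / nh in
    let P := IZR p in
    exists tau_m tau_p : R,
      first_pos_root (fun tau => ell eta p (-1) tau s) tau_m /\
      first_pos_root (fun tau => ell eta p 1 tau s) tau_p /\
      let tau_l := Rmin tau_m tau_p in
      (eta >= - ((P - 1) / P) ->
         is_cut_time p q I1 I3 gam M1 M2 M3 (2 * I1 * tau_l / nh) /\
         2 * I1 * tau_l / nh = 2 * sqrt I1 * sqrt (1 + eta * s ^ 2) * tau_l) /\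
      (-1 < eta < - ((P - 1) / P) ->
         (Rabs s >= (P - 1) / (P * Rabs eta) ->
            is_cut_time p q I1 I3 gam M1 M2 M3 (2 * I1 * PI / nh)) /\
         (Rabs s < (P - 1) / (P * Rabs eta) ->
            is_cut_time p q I1 I3 gam M1 M2 M3 (2 * I1 * tau_l / nh))) /\
      is_cut_time p q I1 I3 gam M1 M2 M3 (2 * I1 * Rmin PI tau_l / nh).
Proof.
intros p q I1 I3 h1 h2 h3 gam M1 M2 M3 Hp _ HI1 HI3 HC Htr eta nh s P.
pose proof (pow2_ge_0 h1) as Q1; pose proof (pow2_ge_0 h2) as Q2; pose proof (pow2_ge_0 h3) as Q3.
assert (Hnh2 : nh ^ 2 = h1 ^ 2 + h2 ^ 2 + h3 ^ 2) by (apply sqrt_sq; lra).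
assert (Hnh : 0 < nh).
{ apply sqrt_lt_R0. destruct (Rlt_le_dec 0 (h1 ^ 2 + h2 ^ 2 + h3 ^ 2)) as [|Hle]; [assumption|exfalso].
  assert (E1 : h1 ^ 2 + h2 ^ 2 = 0) by lra. assert (E2 : h3 ^ 2 = 0) by lra.
  rewrite E1, E2 in HC. unfold Rdiv in HC. lra. }
assert (HP : 2 <= P) by (apply IZR_le in Hp; exact Hp).
assert (He : -1 < eta).
{ unfold eta. assert (0 < I1 / I3) by (apply Rdiv_lt_0_compat; lra). lra. }
assert (Es : s * nh = h3) by (unfold s; field; lra).
assert (Hs2 : s ^ 2 <= 1).
{ apply (Rmult_le_reg_r (nh ^ 2)); [nra|].
  replace (s ^ 2 * nh ^ 2) with ((s * nh) ^ 2) by ring. rewrite Es, Hnh2; lra. }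
assert (Hs : -1 <= s <= 1) by (split; nra).
destruct (cut_parameter_exists eta p s He Hp Hs) as [tm [tp [Hm [Hq [Hcut [Hle Hge]]]]]].
fold P in Hle, Hge.
exists tm, tp. split; [assumption|]. split; [assumption|].
set (tl := Rmin tm tp) in *.
assert (HT : 0 < Rmin PI tl).
{ apply Rmin_glb_lt; [apply PI_RGT_0|]. apply Rmin_glb_lt; [apply Hm|apply Hq]. }
assert (Hmain : is_cut_time p q I1 I3 gam M1 M2 M3 (2 * I1 * Rmin PI tl / nh))
  by (apply (cut_time_of_parameter p q I1 I3 h1 h2 h3); assumption).
assert (Habs : 0 <= Rabs s <= 1) by (split; [apply Rabs_pos|apply Rabs_le; lra]).
assert (HPq : 0 < (P - 1) / P) by (apply Rdiv_lt_0_compat; lra).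
split; [|split; [|exact Hmain]].
- intros Heta. split.
  + rewrite Rmin_right in Hmain; [exact Hmain|]. apply Hle.
    destruct (Rle_lt_dec 0 eta) as [H0|H0].
    * assert (0 <= eta * Rabs s) by (apply Rmult_le_pos; lra). lra.
    * assert (eta <= eta * Rabs s) by nra. lra.
  + assert (Hk : nh ^ 2 * (1 + eta * s ^ 2) = I1).
    { replace (nh ^ 2 * (1 + eta * s ^ 2)) with (nh ^ 2 + eta * (s * nh) ^ 2) by ring.
      rewrite Es, Hnh2. unfold eta.
      transitivity (I1 * ((h1 ^ 2 + h2 ^ 2) / I1 + h3 ^ 2 / I3)); [field; lra|rewrite HC; ring]. }
    assert (Hsq : sqrt I1 = nh * sqrt (1 + eta * s ^ 2)).
    { rewrite <- Hk at 1. rewrite sqrt_mult_alt by nra.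
      rewrite <- Rsqr_pow2, sqrt_Rsqr by lra. reflexivity. }
    assert (Hss : sqrt I1 * sqrt I1 = I1) by (apply sqrt_sqrt; lra).
    assert (Hsn : sqrt (1 + eta * s ^ 2) = sqrt I1 / nh) by (rewrite Hsq; field; lra).
    rewrite Hsn. rewrite <- Hss at 1. field; lra.
- intros [_ Heta].
  assert (Hab : Rabs eta = - eta) by (apply Rabs_left; lra).
  rewrite Hab.
  assert (Ek : (P - 1) / P = (P - 1) / (P * - eta) * - eta) by (field; lra).
  split; intros Hsb.
  + rewrite Rmin_left in Hmain; [exact Hmain|]. apply Hge. rewrite Ek. nra.
  + rewrite Rmin_right in Hmain; [exact Hmain|]. apply Hle. rewrite Ek. nra.
Qed.
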